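(* Let $\Xi\subset\mathbb{R}^m$ be compact, let $\alpha\in(0,1)$, and suppose: (1) $p^*$ is $(C,\rho)$-Hölder continuous for constants $C>0$ and $\rho>0$, i.e. $|p^*(\xi')-p^*(\xi)|\le C\|\xi'-\xi\|_2^\rho$ for any $\xi$ and $\xi'$; (2) there is a constant $U$ with $p^*(\xi)\le U$ for any $\xi\in\Xi$; (3) the kernel $\mathcal{K}:\mathbb{R}^m\to[0,+\infty)$ satisfies $\int_{\mathbb{R}^m}\mathcal{K}(\xi)\,d\xi=1$ and $\mathcal{K}(\xi)=\kappa(\|\xi\|_2)$ for a non-increasing function $\kappa:[0,+\infty)\to[0,+\infty)$, and there exist $r>0$, $C_r>0$ and $\tau>0$ such that $\kappa(t)\le C_r\exp(-t^r)$ for $t>\tau$; (4) $\max_{x\in\mathcal{X},\,\xi\in\Xi}|f(x,\xi)|<+\infty$; (5) the bandwidth satisfies $h>\left(\frac{\log(N/\alpha)}{N}\right)^{1/m}$. Then for any $\epsilon>0$ and $\theta\in(0,1)$ there exists an $N_{\epsilon,\theta}$ such that for any $N\ge N_{\epsilon,\theta}$, $$\mathbb{P}\left(\sup_{x\in\mathcal{X}}\left|\int_\Xi f(x,\xi)p^*(\xi)\,d\xi-\sup_{p\in\mathcal{D}^{KDE}(\widehat\Xi_N,\alpha)}\int_\Xi f(x,\xi)p(\xi)\,d\xi\right|\le\epsilon\right)\ge 1-\theta$$ and $$\mathbb{P}\left(\left|v^*_{\mathcal{D}^{KDE}(\widehat\Xi_N,\alpha)}-v^*\right|\le\epsilon\right)\ge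 1-\theta .$$
   Context: $\xi$ is a random vector in $\mathbb{R}^m$ with probability density function $p^*:\mathbb{R}^m\to[0,+\infty)$ with respect to Lebesgue measure and support $\Xi$. $\widehat\Xi_N=\{\hat\xi_1,\dots,\hat\xi_N\}$ is a set of $N$ i.i.d. samples drawn from $p^*$, and $\mathbb{P}$ is the probability with respect to the draw of $\widehat\Xi_N$. $\mathcal{X}\subseteq\mathbb{R}^n$ is the feasible set and $f:\mathbb{R}^n\times\mathbb{R}^m\to\mathbb{R}$ is the objective function. The optimal value of the stochastic program is $$v^*=\inf_{x\in\mathcal{X}}\int_{\mathbb{R}^m}f(x,\xi)p^*(\xi)\,d\xi .$$ The kernel density estimator with bandwidth $h>0$ is $$\widehat p_h(\xi):=\frac1N\sum_{i=1}^N\frac1{h^m}\mathcal{K}\left(\frac{\xi-\hat\xi_i}{h}\right).$$ Let $V_m$ be the volume of the unit ball in $\mathbb{R}^m$ and set $$C_1=V_mC\int_0^\infty\kappa(t)t^{m+\rho}\,dt,\qquad C_2=8m\sqrt{V_mU}\left(\int_0^\infty\kappa(t)t^{m/2}\,dt+1\right)+64m^2\kappa(0),$$ $$\delta=C_1h^\rho+C_2\sqrt{\frac{\log(N/\alpha)}{Nh^m}} .$$ The KDE confidence band (of significance level $\alpha$) is $$l_\alpha^{KDE}(\xi)=\max\{0,\ \widehat p_h(\xi)-\delta\},\qquad u_\alpha^{KDE}(\xi)=\widehat p_h(\xi)+\delta .$$ With $\mathcal{L}$ the space of all non-negative Lebesgue-measurable functions on $\mathbb{R}^m$, the ambiguity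 set is $$\mathcal{D}^{KDE}(\widehat\Xi_N,\alpha):=\left\{p\in\mathcal{L}\ :\ l_\alpha^{KDE}(\xi)\le p(\xi)\le u_\alpha^{KDE}(\xi)\ \ \forall\,\xi\in\Xi,\ \ \int_\Xi p(\xi)\,d\xi=1\right\},$$ and the optimal value of the distributionally robust problem is $$v^*_{\mathcal{D}^{KDE}(\widehat\Xi_N,\alpha)}:=\inf_{x\in\mathcal{X}}\ \sup_{p\in\mathcal{D}^{KDE}(\widehat\Xi_N,\alpha)}\int_\Xi f(x,\xi)p(\xi)\,d\xi .$$
   Formalization: Besides (5), the bandwidth h = h_N is assumed to satisfy h_N → 0 and log(N/α)/(N h_N^m) → 0, i.e. δ → 0; with (5) alone the claim fails, e.g. for a fixed large h and a large Hölder constant C. *)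

(* Defs.v *)
From HB Require Import structures.
From mathcomp Require Import all_boot all_order all_algebra.
From mathcomp Require Import all_classical all_reals all_analysis.

Set Implicit Arguments.
Unset Strict Implicit.
Unset Printing Implicit Defensive.

Import Order.TTheory GRing.Theory Num.Theory.
Import numFieldNormedType.Exports.

Local Open Scope classical_set_scope.
Local Open Scope ring_scope.

Definition measure_rV_display : measure_display -> measure_display.
Proof. exact. Qed.

(* Product sigma-algebra on row vectors, generated by the coordinates; on
   'rV[R]_n this is the Borel sigma-algebra of R^n. *)
Section measurable_rV.
Context {d} {T : sigmaRingType d}.
Variable n : nat.

Let coord : 'I_n -> 'rV[T]_n -> T := fun i v => v ord0 i.

Let rV_set0 : g_sigma_preimage coord set0.
Proof. exact: sigma_algebra0. Qed.

Let rV_setC A : g_sigma_preimage coord A -> g_sigma_preimage coord (~` A).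
Proof. exact: sigma_algebraC. Qed.

Let rV_bigcup (F : (set 'rV[T]_n)^nat) :
  (forall i, g_sigma_preimage coord (F i)) ->
  g_sigma_preimage coord (\bigcup_i (F i)).
Proof. exact: sigma_algebra_bigcup. Qed.

HB.instance Definition _ := @isMeasurable.Build (measure_rV_display d)
  'rV[T]_n (g_sigma_preimage coord) rV_set0 rV_setC rV_bigcup.

End measurable_rV.

Lemma measurable_coord_rV d (T : sigmaRingType d) n (i : 'I_n) :
  measurable_fun [set: 'rV[T]_n] (fun v => v ord0 i).
Proof.
move=> _ Y mY; rewrite setTI; apply: sub_sigma_algebra => /=.
rewrite -bigcup_seq/=; exists i => /=; first by rewrite mem_index_enum.
by exists Y => //; rewrite setTI.
Qed.

Lemma measurable_fun_rVP d1 d2 (T1 : measurableType d1)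
    (T2 : measurableType d2) n (f : T1 -> 'rV[T2]_n) :
  measurable_fun [set: T1] f <->
  forall i, measurable_fun [set: T1] (fun x => f x ord0 i).
Proof.
split=> [mf i|mf].
  exact: measurableT_comp (measurable_coord_rV i) mf.
suff : measurable `<=` [set A | d1.-measurable (f @^-1` A)].
  by move=> H _ A /H/=; rewrite setTI.
apply: smallest_sub => /=.
  split => /=.
  - by rewrite preimage_set0; exact: measurable0.
  - by move=> A mA; rewrite setTD preimage_setC; exact: measurableC.
  - by move=> F mF; rewrite preimage_bigcup; exact: bigcup_measurable.
rewrite -bigcup_seq => A [i _ [B mB <-]] /=.
rewrite setTI.
by have := mf i measurableT B mB; rewrite setTI.
Qed.

Section cons_rV.
Context {R : realType} (n : nat).

Definition cons_rV (p : R * 'rV[R]_n) : 'rV[R]_n.+1 :=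
  \row_i (if unlift ord0 i is Some j then p.2 ord0 j else p.1).

Definition uncons_rV (v : 'rV[R]_n.+1) : R * 'rV[R]_n :=
  (v ord0 ord0, \row_j v ord0 (lift ord0 j)).

Lemma cons_rVK : cancel cons_rV uncons_rV.
Proof.
move=> [a v]; rewrite /uncons_rV /cons_rV mxE unlift_none /=; congr pair.
by apply/rowP => j; rewrite !mxE liftK.
Qed.

Lemma uncons_rVK : cancel uncons_rV cons_rV.
Proof.
move=> v; apply/rowP => i; rewrite mxE /=.
by case: unliftP => [j ->|->//]; rewrite mxE.
Qed.

Lemma measurable_cons_rV : measurable_fun [set: R * 'rV[R]_n] cons_rV.
Proof.
apply/measurable_fun_rVP => i.
case: (unliftP ord0 i) => [j ->|->].
  under eq_fun do rewrite mxE liftK.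
  exact: measurableT_comp (measurable_coord_rV j) measurable_snd.
by under eq_fun do rewrite mxE unlift_none; exact: measurable_fst.
Qed.

Lemma measurable_uncons_rV : measurable_fun [set: 'rV[R]_n.+1] uncons_rV.
Proof.
apply/measurable_fun_pairP; split => /=.
  exact: measurable_coord_rV.
apply/measurable_fun_rVP => i /=.
by under eq_fun do rewrite mxE; exact: measurable_coord_rV.
Qed.

Variable mu : {sigma_finite_measure set 'rV[R]_n -> \bar R}.

Definition lebesgue_cons : set 'rV[R]_n.+1 -> \bar R :=
  pushforward (@lebesgue_measure R \x mu)%E cons_rV.

Let lebesgue_cons0 : lebesgue_cons set0 = 0%E.
Proof. by rewrite /lebesgue_cons /pushforward preimage_set0 measure0. Qed.

Let lebesgue_cons_ge0 A : (0 <= lebesgue_cons A)%E.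
Proof. by rewrite /lebesgue_cons /pushforward; exact: measure_ge0. Qed.

Let lebesgue_cons_sigma_additive : semi_sigma_additive lebesgue_cons.
Proof.
have mpre (A : set 'rV[R]_n.+1) : measurable A -> measurable (cons_rV @^-1` A).
  by move=> mA; rewrite -[X in measurable X]setTI; exact: measurable_cons_rV.
move=> F mF tF mUF; rewrite /lebesgue_cons /pushforward preimage_bigcup.
apply: measure_semi_sigma_additive.
- by move=> k; exact: mpre.
- apply/trivIsetP => /= i j _ _ ij; rewrite -preimage_setI.
  by move/trivIsetP : tF => /(_ _ _ _ _ ij) ->//; rewrite preimage_set0.
- by rewrite -preimage_bigcup; exact: mpre.
Qed.

HB.instance Definition _ := isMeasure.Build _ _ _ lebesgue_cons
  lebesgue_cons0 lebesgue_cons_ge0 lebesgue_cons_sigma_additive.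

Let lebesgue_cons_sigma_finite : sigma_finite setT lebesgue_cons.
Proof.
have /sigma_finiteP[F [TF ndF Foo]] := sigma_finiteT (@lebesgue_measure R).
have /sigma_finiteP[G [TG ndG Goo]] := sigma_finiteT mu.
exists (fun k => uncons_rV @^-1` (F k `*` G k)).
  apply/esym; rewrite -subTset => v _.
  have : [set: R] (uncons_rV v).1 by [].
  have : [set: 'rV[R]_n] (uncons_rV v).2 by [].
  rewrite TF TG => -[j _ Gj] [i _ Fi]; exists (maxn i j) => //; split => /=.
    by move: Fi; exact/subsetPset/ndF/leq_maxl.
  by move: Gj; exact/subsetPset/ndG/leq_maxr.
move=> k; have [mF Fk] := Foo k; have [mG Gk] := Goo k; split.
  rewrite -[X in measurable X]setTI.
  by apply: measurable_uncons_rV => //; exact: measurableX.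
rewrite /lebesgue_cons /pushforward -comp_preimage.
rewrite (_ : _ \o _ = id); last by apply/funext => x /=; rewrite cons_rVK.
by rewrite preimage_id product_measure1E// lte_mul_pinfty// ge0_fin_numE.
Qed.

HB.instance Definition _ := @Measure_isSigmaFinite.Build _ _ _ lebesgue_cons
  lebesgue_cons_sigma_finite.

End cons_rV.

(* Lebesgue measure on the Borel sets of R^n: the n-fold product of the
   one-dimensional Lebesgue measure. *)
Fixpoint borel_lebesgue {R : realType} (n : nat) :
    {sigma_finite_measure set 'rV[R]_n -> \bar R} :=
  match n with
  | 0 => @dirac _ 'rV[R]_0 0 R
  | n'.+1 => lebesgue_cons (borel_lebesgue n')
  end.

Lemma borel_lebesgue_box (R : realType) (n : nat) (A : 'I_n -> set R) :
  (forall i, measurable (A i)) ->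
  borel_lebesgue n [set v : 'rV[R]_n | forall i, A i (v ord0 i)] =
  (\prod_(i < n) lebesgue_measure (A i))%E.
Proof.
elim: n A => [|n IH] A mA /=.
  rewrite big_ord0 diracE (_ : _ \in _ = true)//.
  by apply/mem_set => -[].
have mA' : measurable [set v : 'rV[R]_n | forall i, A (lift ord0 i) (v ord0 i)].
  rewrite [X in measurable X](_ : _ =
      \bigcap_(i in [set: 'I_n]) ((fun v : 'rV[R]_n => v ord0 i) @^-1` A (lift ord0 i))).
    apply: fin_bigcap_measurable => // i _.
    by rewrite -[X in measurable X]setTI; exact: measurable_coord_rV.
  by apply/seteqP; split => v /= H i => [_|]; exact: H.
rewrite big_ord_recl /lebesgue_cons /pushforward.
rewrite (_ : cons_rV (n := n) @^-1` _ =
  A ord0 `*` [set v : 'rV[R]_n | forall i, A (lift ord0 i) (v ord0 i)]);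
  last first.
  apply/seteqP; split => -[a v] /=.
    move=> H; split => /=; first by have := H ord0; rewrite mxE unlift_none.
    by move=> i; have := H (lift ord0 i); rewrite mxE liftK.
  by move=> [H0 H] i; rewrite mxE; case: unliftP => [j ->|->] //; exact: H.
rewrite product_measure1E//; last exact: mA.
by rewrite (IH (fun i => A (lift ord0 i))).
Qed.

(* R^n with its Lebesgue-measurable sets: the Caratheodory sigma-algebra of
   the Lebesgue outer measure. *)
Definition lebesgueType (R : realType) (n : nat) :=
  caratheodory_type ((@borel_lebesgue R n)^*)%mu.

HB.instance Definition _ R n := Measurable.on (lebesgueType R n).

Definition leb {R : realType} (n : nat) :
    {measure set (lebesgueType R n) -> \bar R} :=
  @completed_measure_extension _ _ _ (@borel_lebesgue R n).

Section kde.
Context {R : realType} {m : nat}.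
Implicit Types (p : 'rV[R]_m -> R) (xi : 'rV[R]_m).

Definition norm2 xi : R := Num.sqrt (\sum_(i < m) xi ord0 i ^+ 2).

Definition is_density p :=
  [/\ forall xi, 0 <= p xi,
      measurable_fun [set: lebesgueType R m] p &
      (\int[leb m]_xi (p xi)%:E = 1)%E].

Definition density_support p : set 'rV[R]_m := closure [set xi | p xi != 0].

Definition holder (C rho : R) p :=
  forall xi xi', `|p xi' - p xi| <= C * norm2 (xi' - xi) `^ rho.

Definition iid_sample d (Omega : measurableType d) (P : probability Omega R)
    p (N : nat) (s : 'I_N -> {RV P >-> 'rV[R]_m}) :=
  (forall i (A : set 'rV[R]_m), measurable A ->
     distribution P (s i) A = \int[leb m]_(xi in A) (p xi)%:E)%E /\
  (forall A : 'I_N -> set 'rV[R]_m, (forall i, measurable (A i)) ->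
     P (\bigcap_i (s i @^-1` A i)) = \prod_(i < N) P (s i @^-1` A i))%E.

Variables (K : 'rV[R]_m -> R) (kappa : R -> R).

(* kappa is only meaningful on [0, +oo[ *)
Definition radial_kernel :=
  [/\ forall xi, 0 <= K xi,
      (\int[leb m]_xi (K xi)%:E = 1)%E,
      forall xi, K xi = kappa (norm2 xi),
      (forall t, 0 <= t -> 0 <= kappa t) /\
      (forall t u, 0 <= t -> t <= u -> kappa u <= kappa t) &
      exists r Cr tau : R, [/\ 0 < r, 0 < Cr, 0 < tau &
        forall t, tau < t -> kappa t <= Cr * expR (- (t `^ r))]].

Definition unit_ball_volume : R :=
  fine (leb m [set xi | norm2 xi <= 1]).

Definition C1 (C rho : R) : R :=
  unit_ball_volume * C *
  \int[lebesgue_measure]_(t in `[0, +oo[) (kappa t * t `^ (m%:R + rho)).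

Definition C2 (U : R) : R :=
  8 * m%:R * Num.sqrt (unit_ball_volume * U) *
  (\int[lebesgue_measure]_(t in `[0, +oo[) (kappa t * t `^ (m%:R / 2)) + 1) +
  64 * m%:R ^+ 2 * kappa 0.

Definition half_width (C rho U alpha h : R) (N : nat) : R :=
  C1 C rho * h `^ rho +
  C2 U * Num.sqrt (ln (N%:R / alpha) / (N%:R * h ^+ m)).

Definition kde (h : R) (N : nat) (s : 'I_N -> 'rV[R]_m) xi : R :=
  N%:R^-1 * \sum_(i < N) (h ^+ m)^-1 * K (h^-1 *: (xi - s i)).

Definition band_lower (delta h : R) N (s : 'I_N -> 'rV[R]_m) xi : R :=
  Num.max 0 (kde h s xi - delta).

Definition band_upper (delta h : R) N (s : 'I_N -> 'rV[R]_m) xi : R :=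
  kde h s xi + delta.

Definition ambiguity_set (Xi : set 'rV[R]_m) (delta h : R) N
    (s : 'I_N -> 'rV[R]_m) : set ('rV[R]_m -> R) :=
  [set p : 'rV[R]_m -> R |
    [/\ forall xi, 0 <= p xi,
        measurable_fun [set: lebesgueType R m] p,
        forall xi, Xi xi ->
          band_lower delta h s xi <= p xi <= band_upper delta h s xi &
        (\int[leb m]_(xi in Xi) (p xi)%:E = 1)%E]].

End kde.

Arguments unit_ball_volume R m : clear implicits.
Arguments C1 {R} m kappa C rho.
Arguments C2 {R} m kappa U.
Arguments half_width {R} m kappa C rho U alpha h N.

Section programs.
Context {R : realType} {m n : nat}.
Variable f : 'rV[R]_n -> 'rV[R]_m -> R.
Local Open Scope ereal_scope.

Definition expected_cost (D : set 'rV[R]_m) (p : 'rV[R]_m -> R)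
    (x : 'rV[R]_n) : \bar R :=
  \int[leb m]_(xi in D) (f x xi * p xi)%:E.

Definition stochastic_value (X : set 'rV[R]_n) (p : 'rV[R]_m -> R) : \bar R :=
  ereal_inf [set expected_cost setT p x | x in X].

Definition worst_case (Xi : set 'rV[R]_m) (D : set ('rV[R]_m -> R))
    (x : 'rV[R]_n) : \bar R :=
  ereal_sup [set expected_cost Xi p x | p in D].

Definition robust_value (X : set 'rV[R]_n) (Xi : set 'rV[R]_m)
    (D : set ('rV[R]_m -> R)) : \bar R :=
  ereal_inf [set worst_case Xi D x | x in X].

End programs.

(* The events considered involve uncountable suprema and infima and need not
   be measurable, so probabilities are bounded below through the inner
   measure, which is P itself on measurable events. *)
Definition inner_prob d (Omega : measurableType d) (R : realType)
    (P : probability Omega R) (E : set Omega) : \bar R :=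
  ereal_sup [set P A | A in [set A | measurable A /\ A `<=` E]].

(* Main.v *)
Require Import Defs.
From HB Require Import structures.
From mathcomp Require Import all_boot all_order all_algebra.
From mathcomp Require Import all_classical all_reals all_analysis.
From mathcomp Require Import measurable_realfun ring lra.
Import Order.TTheory GRing.Theory Num.Theory.
Import numFieldNormedType.Exports.
Local Open Scope classical_set_scope.
Local Open Scope ring_scope.
Set Implicit Arguments.
Unset Strict Implicit.
Unset Printing Implicit Defensive.

(** Two properties of the sample, each of which holds with probability close to
    one, imply both conclusions: the integral over [Xi] of [(kde - p) ^ 2] is
    small, and the mass that the estimator [kde] leaks out of [Xi] is at most
    [delta * |Xi|], where [delta] is the half-width of the band.

    The implication is deterministic. The band with edges [l <= u] contains a
    density on [Xi] as soon as [l] integrates to at most [1] and [u] to at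
    least [1]; the former holds because [kde] has total mass [1], the latter is
    the bound on the leak ([ambiguity_set_nonempty]). Every density in the band
    is within [delta] of [kde], hence close to [p] in mean
    ([ambiguity_set_close]). As [f] is bounded, its expectations under [p] and
    under all the members of the ambiguity set are close, uniformly in [x]
    ([expected_cost_close]), and this passes to suprema and infima
    ([worst_case_close], [robust_value_close]).

    By Markov's inequality and Tonelli's theorem, the two properties follow
    from bounds on pointwise expectations. The expectation of [kde] is the
    smoothed density [b = K_h * p]. Hoelder continuity bounds [|b - p|] by
    [C * h ^ rho] times the moment of order [rho] of the kernel
    ([smoothed_bias]), which is finite thanks to the exponential tail
    ([radial_kernel_moment]). By pairwise independence the variance of [kde] at
    [x] is at most [kappa 0 * b x / (N * h ^ m)], and [b] has integral [1]. This
    gives [expected_square_error], whose right-hand side vanishes in the limit,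
    since [ln (N / alpha)] is bounded below by [ln (1 / alpha) > 0].

    The expected leak is the integral of [b] over the complement of [Xi], and it
    is [o (h ^ rho)] ([smoothed_leak]). Indeed [p = 0] off [Xi], so [b] is at most
    a multiple of [h ^ rho] there, and this is used on a collar around [Xi]
    whose measure is arbitrarily small ([small_collar]); the contribution of the
    points at distance at least [eta] from [Xi] is of order
    [(h / eta) ^ (rho + 1)]. On the other hand [delta >= C1 * h ^ rho] with
    [C1 > 0] ([C1_gt0]), so that the expected leak is negligible against
    [delta * |Xi|]. *)

(** * Borel sets and Lebesgue measure of row vectors *)

Definition box (R : realType) n (A : 'I_n -> set R) : set 'rV[R]_n :=
  [set v | forall i, A i (v ord0 i)].

Lemma measurable_box (R : realType) n (A : 'I_n -> set R) :
  (forall i, measurable (A i)) -> measurable (box A).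
Proof.
move=> mA; rewrite [X in measurable X](_ : _ =
    \bigcap_(i in [set: 'I_n]) ((fun v : 'rV[R]_n => v ord0 i) @^-1` A i)).
  apply: fin_bigcap_measurable => // i _.
  by rewrite -[X in measurable X]setTI; exact: measurable_coord_rV.
by apply/seteqP; split => v /= H i => [_|]; exact: H.
Qed.

Definition cube (R : realType) n (r : R) : set 'rV[R]_n :=
  box (fun=> `[- r, r]%classic).

Lemma boxI (R : realType) n (A B : 'I_n -> set R) :
  box A `&` box B = box (fun i => A i `&` B i).
Proof.
apply/seteqP; split => [v [vA vB] i|v vAB]; first by split.
by split => i; have [] := vAB i.
Qed.

Lemma measurable_rV_boxE (R : realType) n :
  @measurable _ 'rV[R]_n =
  <<s [set box A | A in [set A : 'I_n -> set R | forall i, measurable (A i)]] >>.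
Proof.
apply/seteqP; split.
  apply: smallest_sub; first exact: smallest_sigma_algebra.
  rewrite -bigcup_seq => _ [i _ [B mB <-]].
  apply: sub_sigma_algebra; exists (fun j => if j == i then B else setT).
    by move=> j /=; case: ifP.
  rewrite setTI; apply/seteqP; split => v /=.
    by move=> /(_ i); rewrite eqxx.
  by move=> Bv j; case: eqP => // ->.
apply: smallest_sub; first exact: sigma_algebra_measurable.
by move=> _ [A mA <-]; exact: measurable_box.
Qed.

(** Boxes are stable under intersection and generate the sigma-algebra, and
    the cubes exhaust the space, so this is an instance of the uniqueness of
    sigma-finite measures on a pi-system. *)
Lemma borel_measure_unique (R : realType) n
    (mu nu : {measure set 'rV[R]_n -> \bar R}) :
  (forall A : 'I_n -> set R, (forall i, measurable (A i)) ->
    mu (box A) = nu (box A)) ->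
  (forall k : nat, (mu (@cube R n k%:R) < +oo)%E) ->
  forall A, measurable A -> mu A = nu A.
Proof.
move=> munu mufin A mA.
apply: (measure_unique
  [set box A | A in [set A : 'I_n -> set R | forall i, measurable (A i)]]
  (fun k => @cube R n k%:R)) => //.
- exact: measurable_rV_boxE.
- move=> _ _ [B mB <-] [D mD <-]; rewrite boxI.
  by exists (fun i => B i `&` D i) => // i; exact: measurableI.
- by move=> k; exists (fun=> `[- k%:R, k%:R]%classic).
- rewrite -subTset => v _.
  pose k := Num.bound `|v|.
  exists k => // i /=; rewrite in_itv /= -ler_norml.
  apply: (@le_trans _ _ `|v|); last exact/ltW/archi_boundP.
  rewrite [leRHS]mx_normrE.
  exact: (le_bigmax_cond _ (fun ij => `|v ij.1 ij.2|) (j := (ord0, i))).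
- by move=> _ [B mB <-]; exact: munu.
Qed.

(** Packages a push-forward as a measure, so that the uniqueness lemmas, which
    quantify over measures, apply to it. *)
Lemma image_measure_exists d d' (T1 : measurableType d) (T2 : measurableType d')
    (R : realType) (mu : {measure set T1 -> \bar R}) (f : T1 -> T2) :
  measurable_fun setT f ->
  exists nu : {measure set T2 -> \bar R}, forall A, nu A = mu (f @^-1` A).
Proof. by move=> mf; unshelve eexists; first exact: (pushforward mu f). Qed.

Lemma lebesgue_measure_affine (R : realType) (h y : R) (A : set R) : 0 < h ->
  measurable A ->
  lebesgue_measure ((fun t => h^-1 * (t - y)) @^-1` A) =
  (h%:E * lebesgue_measure A)%E.
Proof.
move=> h0 mA.
have h0' : 0 <= h^-1 by rewrite invr_ge0 ltW.
have mphi : measurable_fun [set: measurableTypeR R]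
    ((fun t => h^-1 * (t - y)) : _ -> measurableTypeR R).
  by apply: measurable_funM => //; apply: measurable_funB.
have [nu nuE] := image_measure_exists lebesgue_measure mphi.
rewrite (@lebesgue_measure_unique _ (mscale (NngNum h0') nu) _ A mA).
  by rewrite /= /mscale /= nuE muleA -EFinM divff ?gt_eqF// mul1e.
move=> _ [[a b]] _ <-; rewrite /= /mscale /= nuE.
rewrite (_ : _ @^-1` _ = `](a * h + y), (b * h + y)]%classic); last first.
  apply/seteqP; split => t /=; rewrite !in_itv /= => /andP[].
    by rewrite mulrC ltr_pdivlMr// ler_pdivrMr// ltrBrDr lerBlDr => -> ->.
  by rewrite [h^-1 * _]mulrC ltr_pdivlMr// ler_pdivrMr// ltrBrDr lerBlDr => -> ->.
rewrite !lebesgue_measure_itv /= lebesgue_measure_itv /= !lte_fin.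
rewrite ltrD2r ltr_pM2r//; case: ifPn => _; last by rewrite mule0.
rewrite -!EFinD -EFinM; congr EFin.
by field; rewrite gt_eqF.
Qed.

Lemma borel_lebesgue_boxE (R : realType) n (A : 'I_n -> set R) :
  (forall i, measurable (A i)) ->
  borel_lebesgue n (box A) = (\prod_(i < n) lebesgue_measure (A i))%E.
Proof. exact: borel_lebesgue_box. Qed.

Lemma borel_lebesgue_cube (R : realType) n (r : R) : 0 <= r ->
  borel_lebesgue n (@cube R n r) = ((2 * r) ^+ n)%:E.
Proof.
move=> r0; rewrite borel_lebesgue_box//.
rewrite (eq_bigr (fun=> (2 * r)%:E)).
  by rewrite prodEFin prodr_const card_ord.
move=> i _; rewrite lebesgue_measure_itv /= lte_fin.
have [rr|] := ltP; first by rewrite -EFinD; congr EFin; lra.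
by move=> ?; congr EFin; lra.
Qed.

Lemma measurable_affine (R : realType) n (a : R) (y : 'rV[R]_n) :
  measurable_fun [set: 'rV[R]_n] ((fun x => a *: (x - y)) : _ -> 'rV[R]_n).
Proof.
apply/measurable_fun_rVP => i.
under eq_fun do rewrite !mxE.
apply: measurable_funM => //; apply: measurable_funB => //.
exact: measurable_coord_rV.
Qed.

(** The push-forward by the affine map multiplies each side of a box by [h], so
    after division by [h ^+ n] it agrees with the measure itself on boxes. *)
Lemma borel_lebesgue_affine (R : realType) n (h : R) (y : 'rV[R]_n)
    (A : set 'rV[R]_n) : 0 < h -> measurable A ->
  borel_lebesgue n ((fun x => h^-1 *: (x - y)) @^-1` A) =
  ((h ^+ n)%:E * borel_lebesgue n A)%E.
Proof.
move=> h0 mA.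
have h0' : 0 <= (h ^+ n)^-1 by rewrite invr_ge0 exprn_ge0// ltW.
have [nu nuE] : exists nu : {measure set 'rV[R]_n -> \bar R}, forall B,
    nu B = borel_lebesgue n ((fun x => h^-1 *: (x - y)) @^-1` B).
  exact: image_measure_exists (measurable_affine h^-1 y).
rewrite (@borel_measure_unique _ _ (borel_lebesgue n) (mscale (NngNum h0') nu) _ _ A mA).
- by rewrite /= /mscale /= nuE muleA -EFinM divff ?mul1e// expf_neq0// gt_eqF.
- move=> B mB; rewrite /= /mscale /= nuE.
  rewrite (_ : _ @^-1` _ =
      box (fun i => (fun t => h^-1 * (t - y ord0 i)) @^-1` B i)); last first.
    by apply/seteqP; split => v /= Bv i; have := Bv i; rewrite !mxE.
  rewrite borel_lebesgue_boxE// borel_lebesgue_boxE; last first.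
    move=> i; rewrite -[X in measurable X]setTI.
    have : measurable_fun [set: R] (fun t : R => h^-1 * (t - y ord0 i)).
      by apply: measurable_funM => //; apply: measurable_funB.
    by apply.
  rewrite [in RHS](eq_bigr (fun i => h%:E * lebesgue_measure (B i))%E); last first.
    by move=> i _; rewrite lebesgue_measure_affine.
  rewrite big_split /= prodEFin prodr_const card_ord muleA -EFinM mulVf.
    by rewrite mul1e.
  by rewrite expf_neq0// gt_eqF.
- move=> k; suff : (borel_lebesgue n (@cube R n k%:R) < +oo)%E by [].
  by rewrite borel_lebesgue_cube// ltry.
Qed.

Section Borel_sets.
Context {R : realType} {n : nat}.
Implicit Types (v w x y : 'rV[R]_n) (O F : set 'rV[R]_n).

Let rat_cube (qk : 'rV[rat]_n * nat) : set 'rV[R]_n :=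
  box (fun i => ball (ratr (qk.1 ord0 i) : R) qk.2.+1%:R^-1).

(** The topology has a countable base of cubes with rational centres, whereas
    the sigma-algebra is generated by the coordinates. *)
Lemma open_measurable_rV O : open O -> measurable O.
Proof.
move=> oO.
(* the rational cubes inside [O], enumerated by the codes of their data *)
have -> : O = \bigcup_(j : nat)
    (if unpickle j is Some qk then
       if `[< rat_cube qk `<=` O >] then rat_cube qk else set0 else set0).
  apply/seteqP; split => [v Ov|v [j _]]; last first.
    case: unpickle => [qk|//]; case: ifPn => // /asboolP; exact.
  have /nbhs_ballP[e /= e0 veO] : nbhs v O by exact: open_nbhs_nbhs.
  have [k ke] : exists k : nat, k.+1%:R^-1 < e / 2.
    have e2 : 0 < e / 2 by rewrite divr_gt0.
    by have [k _ /(_ k (leqnn k))] := near_infty_natSinv_lt (PosNum e2); exists k.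
  have k0 : 0 < k.+1%:R^-1 :> R by rewrite invr_gt0.
  have /choice[q qv] : forall i, exists r : rat,
      ball (ratr r : R) k.+1%:R^-1 (v ord0 i).
    move=> i.
    have /rat_in_itvoo[r] : v ord0 i < v ord0 i + k.+1%:R^-1.
      by rewrite ltrDl.
    rewrite in_itv /= => /andP[r1 r2]; exists r.
    by rewrite /ball /= ltr_distl r2 andbT (lt_trans _ r1)// ltrBlDr ltrDl.
  have vq : rat_cube (\row_i q i, k) v by move=> i /=; rewrite mxE.
  exists (pickle (\row_i q i, k)) => //.
  rewrite pickleK ifT//; apply/asboolP => w wq; apply: veO; split => // i j.
  rewrite ord1; have /= := wq j; rewrite mxE => wj.
  have := ball_triangle (ball_sym (qv j)) wj.
  by apply: le_ball; rewrite (splitr e) lerD// ltW.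
apply: bigcupT_measurable => j; case: unpickle => // qk.
case: ifPn => // _; apply: measurable_box => i.
by apply: open_measurable; exact: ball_open.
Qed.

Lemma closed_measurable_rV F : closed F -> measurable F.
Proof.
move=> cF; rewrite -(setCK F); apply: measurableC; apply: open_measurable_rV; exact: closed_openC.
Qed.

Lemma borel_measurable_lebesgueType (A : set 'rV[R]_n) :
  measurable A -> measurable (A : set (lebesgueType R n)).
Proof. exact: caratheodory_measurable_mu_ext. Qed.

Lemma measurable_funT_lebesgueType d (T : measurableType d)
    (g : 'rV[R]_n -> T) :
  measurable_fun setT g -> measurable_fun [set: lebesgueType R n] g.
Proof.
move=> mg _ Y mY; apply: borel_measurable_lebesgueType; exact: mg.
Qed.

Lemma leb_borelE (A : set 'rV[R]_n) : measurable A ->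
  leb n A = borel_lebesgue n A.
Proof. by move=> mA; exact: measurable_mu_extE. Qed.

(** Tonelli's theorem is used with the sigma-finite measure on the Borel sets;
    this carries Borel integrands over from the completed measure, which is
    pushed forward to it by the identity. *)
Lemma integral_leb (D : set 'rV[R]_n) (g : 'rV[R]_n -> \bar R) :
  measurable D -> measurable_fun D g -> (forall x, D x -> 0 <= g x)%E ->
  (\int[leb n]_(x in D) g x = \int[borel_lebesgue n]_(x in D) g x)%E.
Proof.
move=> mD mg g0.
pose phi : lebesgueType R n -> 'rV[R]_n := idfun.
have mphi : measurable_fun setT phi.
  by move=> _ Y mY; rewrite setTI; exact: borel_measurable_lebesgueType.
transitivity (\int[pushforward (leb n) phi]_(x in D) g x)%E.
  rewrite ge0_integral_pushforward//.
  by move=> x /[!inE]; exact: g0.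
by apply: eq_measure_integral => A mA _; exact: leb_borelE.
Qed.

Lemma integral_affine (h : R) y (g : 'rV[R]_n -> \bar R) : 0 < h ->
  measurable_fun setT g -> (forall x, 0 <= g x)%E ->
  (\int[borel_lebesgue n]_x g (h^-1 *: (x - y)) =
   (h ^+ n)%:E * \int[borel_lebesgue n]_x g x)%E.
Proof.
move=> h0 mg g0.
pose phi := (fun x => h^-1 *: (x - y)) : 'rV[R]_n -> 'rV[R]_n.
have mphi : measurable_fun [set: 'rV[R]_n] phi := measurable_affine h^-1 y.
have hn0 : 0 <= h ^+ n by rewrite exprn_ge0// ltW.
rewrite -[LHS]/(\int[borel_lebesgue n]_(x in phi @^-1` setT) (g \o phi) x)%E.
rewrite -ge0_integral_pushforward//.
rewrite -[(h ^+ n)%:E]/((NngNum hn0)%:num%:E) -ge0_integral_mscale//.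
apply: eq_measure_integral => A mA _.
exact: borel_lebesgue_affine.
Qed.

End Borel_sets.

(** * Norm and tails of a radial kernel *)

Section Euclidean_norm.
Context {R : realType} {n : nat}.
Implicit Types x y : 'rV[R]_n.

Lemma norm2_ge0 x : 0 <= norm2 x.
Proof. exact: sqrtr_ge0. Qed.

Lemma norm2N x : norm2 (- x) = norm2 x.
Proof.
by rewrite /norm2; congr Num.sqrt; apply: eq_bigr => i _; rewrite mxE sqrrN.
Qed.

Lemma norm2Z (c : R) x : 0 <= c -> norm2 (c *: x) = c * norm2 x.
Proof.
move=> c0; rewrite /norm2.
under eq_bigr do rewrite mxE exprMn.
by rewrite -mulr_sumr sqrtrM ?sqr_ge0// sqrtr_sqr ger0_norm.
Qed.

Lemma ler_coord_norm2 x i : `|x ord0 i| <= norm2 x.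
Proof.
rewrite -sqrtr_sqr ler_wsqrtr// (bigD1 i)//= lerDl sumr_ge0// => j _.
exact: sqr_ge0.
Qed.

Lemma ler_mx_norm_norm2 x : `|x| <= norm2 x.
Proof.
rewrite [leLHS]mx_normrE; apply: bigmax_le => [|[i j] _ /=].
  exact: norm2_ge0.
by rewrite ord1; exact: ler_coord_norm2.
Qed.

Lemma norm2_le_cube x (r : R) : 0 <= r -> (forall i, `|x ord0 i| <= r) ->
  norm2 x <= n%:R * r.
Proof.
move=> r0 xr.
rewrite -[leRHS]ger0_norm ?mulr_ge0// -sqrtr_sqr ler_wsqrtr//.
apply: (@le_trans _ _ (\sum_(i < n) r ^+ 2)).
  by apply: ler_sum => i _; rewrite -real_normK ?num_real// lerXn2r ?nnegrE.
rewrite sumr_const card_ord exprMn -[leLHS]mulr_natl ler_wpM2r ?sqr_ge0//.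
by rewrite -natrX ler_nat; case: (n) => // k; rewrite -mulnn leq_pmulr.
Qed.

Lemma measurable_norm2 : measurable_fun [set: 'rV[R]_n] (@norm2 R n).
Proof.
have -> : @norm2 R n = (@powR R ^~ 2^-1) \o (fun x => \sum_(i < n) x ord0 i ^+ 2).
  by apply/funext => x /=; rewrite powR12_sqrt// sumr_ge0// => i _; exact: sqr_ge0.
apply: measurableT_comp; first exact: measurable_powR.
apply: measurable_sum => i; apply: measurable_funX.
exact: measurable_coord_rV.
Qed.

Lemma measurable_norm2_powR (s : R) :
  measurable_fun [set: 'rV[R]_n] (fun x => norm2 x `^ s).
Proof. by have := measurableT_comp (measurable_powR s) measurable_norm2. Qed.

End Euclidean_norm.

(** The profile is only monotone on the nonnegative reals; precomposing it with
    [Num.max 0] makes it monotone, hence measurable, on the whole line. *)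
Lemma measurable_radial_kernel (R : realType) n (K : 'rV[R]_n -> R) kappa :
  radial_kernel K kappa -> measurable_fun setT K.
Proof.
move=> [_ _ KE [_ kappani] _].
pose kappa' t := kappa (Num.max 0 t).
have -> : K = kappa' \o @norm2 R n.
  by apply/funext => x /=; rewrite KE /kappa' max_r// norm2_ge0.
apply: measurableT_comp measurable_norm2.
apply: nonincreasing_measurable => // s t st.
apply: kappani; first by rewrite le_max lexx.
by rewrite ge_max !le_max lexx st orbT.
Qed.

Lemma radial_kernel_le0 (R : realType) n (K : 'rV[R]_n -> R) kappa x :
  radial_kernel K kappa -> K x <= kappa 0.
Proof. by move=> [_ _ -> [_ kappani] _]; apply: kappani => //; exact: norm2_ge0. Qed.

Lemma radial_kernelN (R : realType) n (K : 'rV[R]_n -> R) kappa x :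
  radial_kernel K kappa -> K (- x) = K x.
Proof. by move=> [_ _ KE _ _]; rewrite !KE norm2N. Qed.

(** The bound [exp (- u) <= k! / u ^ k], applied to [u = t ^ r] with [k] large,
    shows that the tail decays faster than any power. The comparison function
    is a power of [1 / (1 + t ^ 2)] because the latter has a known integral
    and is dominated, on the norm of a vector, by a product over coordinates. *)
Lemma exp_tail_le_oneDsqr (R : realType) n (K : 'rV[R]_n -> R) kappa (m : nat)
    (s : R) : radial_kernel K kappa -> 0 <= s ->
  exists2 A : R, 0 <= A & forall t, 0 <= t ->
    kappa t * t `^ s <= A * (oneDsqr t ^+ m)^-1.
Proof.
move=> [_ _ _ [kappa0 kappani] [r [Cr [tau [r0 Cr0 tau0 tail]]]]] s0.
pose T := Num.max tau 1.
have T1 : 1 <= T by rewrite le_max lexx orbT.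
pose q := s + (2 * m)%:R.
have q0 : 0 <= q by rewrite addr_ge0.
have [k kq] : exists k : nat, q <= r * k.+1%:R.
  exists (Num.bound (q / r)); rewrite mulrC -ler_pdivrMr// ltW//.
  rewrite (lt_le_trans (archi_boundP _))// ?divr_ge0//; first exact: ltW.
  by rewrite ler_nat.
(* [A1] controls the range [t <= T], [A2] the range [t > T] *)
pose A1 := kappa 0 * T `^ s * oneDsqr T ^+ m.
pose A2 := Cr * (k.+1)`!%:R * 2 ^+ m.
have A10 : 0 <= A1.
  by rewrite !mulr_ge0 ?powR_ge0 ?kappa0// exprn_ge0// (le_trans ler01)// oneDsqr_ge1.
have A20 : 0 <= A2 by rewrite !mulr_ge0 ?exprn_ge0// ltW.
exists (A1 + A2); first exact: addr_ge0.
move=> t t0; have Dt : 0 < oneDsqr t ^+ m.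
  by rewrite exprn_gt0// (lt_le_trans ltr01)// oneDsqr_ge1.
rewrite ler_pdivlMr//.
have [tT|Tt] := leP t T.
  apply: (@le_trans _ _ A1); last by rewrite lerDl.
  rewrite ler_pM ?mulr_ge0 ?powR_ge0 ?kappa0 ?(ltW Dt)//.
    rewrite ler_pM ?powR_ge0 ?kappa0//; first by rewrite kappani.
    by rewrite ge0_ler_powR ?nnegrE// (le_trans ler01).
  apply: lerXn2r; rewrite ?nnegrE; [exact: le_trans ler01 (oneDsqr_ge1 _)..|].
  by rewrite /oneDsqr lerD2l; apply: lerXn2r; rewrite ?nnegrE// (le_trans ler01).
apply: (@le_trans _ _ A2); last by rewrite lerDr.
have t1 : 1 <= t by rewrite (le_trans T1)// ltW.
have tpos : 0 < t by rewrite (lt_le_trans ltr01).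
have taut : tau < t by rewrite (le_lt_trans _ Tt)// le_max lexx.
have tq0 : 0 < t `^ q by rewrite powR_gt0.
have kt : kappa t <= Cr * ((k.+1)`!%:R / t `^ q).
  apply: (le_trans (tail _ taut)); rewrite ler_pM2l// expRN.
  rewrite -[leRHS]invrK lef_pV2 ?posrE ?expR_gt0 ?invr_gt0 ?divr_gt0//.
  rewrite invf_div; apply: le_trans (expR_ge1Dxn k (powR_ge0 t r)).
  rewrite -powR_mulrn ?powR_ge0// -powRrM.
  rewrite (@le_trans _ _ (t `^ (r * k.+1%:R) / (k.+1)`!%:R))// ?lerDr//.
  by rewrite ler_wpM2r ?invr_ge0// ler_powR.
have Dt2 : oneDsqr t ^+ m <= 2 ^+ m * t `^ (2 * m)%:R.
  rewrite powR_mulrn// exprM -exprMn; apply: lerXn2r;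
    rewrite ?nnegrE ?mulr_ge0 ?sqr_ge0 ?(le_trans ler01 (oneDsqr_ge1 _))//.
  by rewrite /oneDsqr mulr_natl mulr2n lerD2r exprn_ege1.
apply: (@le_trans _ _ (Cr * ((k.+1)`!%:R / t `^ q) * t `^ s *
    (2 ^+ m * t `^ (2 * m)%:R))).
  rewrite ler_pM ?mulr_ge0 ?powR_ge0 ?kappa0 ?(ltW Dt)//.
  by rewrite ler_wpM2r ?powR_ge0.
have tqE : t `^ q = t `^ s * t `^ (2 * m)%:R.
  by rewrite powRD//; apply/implyP => _; rewrite gt_eqF.
rewrite /A2 le_eqVlt; apply/orP; left; apply/eqP.
rewrite [X in _ / X]tqE; field.
by rewrite !gt_eqF ?powR_gt0.
Qed.

(** Tonelli's theorem, one coordinate at a time. *)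
Lemma integral_prod_coord (R : realType) n (g : R -> R) (c : R) :
  measurable_fun setT g -> (forall t, 0 <= g t) ->
  (\int[lebesgue_measure]_t (g t)%:E = c%:E)%E ->
  (\int[borel_lebesgue n]_x (\prod_(i < n) g (x ord0 i))%:E = (c ^+ n)%:E)%E.
Proof.
move=> mg g0 gc.
have mprod k : measurable_fun [set: 'rV[R]_k]
    (fun x => \prod_(i < k) g (x ord0 i)).
  apply: measurable_prod => i _.
  by apply: measurableT_comp => //; exact: measurable_coord_rV.
elim: n => [|n IH].
  rewrite integral_dirac//.
    by rewrite diracT mul1e big_ord0.
  by apply/measurable_EFinP; exact: mprod.
transitivity (\int[(lebesgue_measure \x borel_lebesgue n)%E]_z
   ((g z.1)%:E * (\prod_(i < n) g (z.2 ord0 i))%:E))%E.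
  transitivity (\int[pushforward (lebesgue_measure \x borel_lebesgue n)%E
      (@cons_rV R n)]_x (\prod_(i < n.+1) g (x ord0 i))%:E)%E; first by [].
  rewrite ge0_integral_pushforward//; last 3 first.
  - exact: measurable_cons_rV.
  - by apply/measurable_EFinP; exact: mprod.
  - by move=> x _; rewrite lee_fin prodr_ge0.
  rewrite preimage_setT.
  apply: eq_integral => z _ /=; rewrite big_ord_recl -EFinM.
  rewrite mxE unlift_none; congr (EFin (_ * _)).
  by apply: eq_bigr => i _; rewrite mxE liftK.
rewrite fubini_tonelli1//=; last 2 first.
- apply: emeasurable_funM; apply/measurable_EFinP.
    by apply: measurableT_comp.
  by apply: measurableT_comp (mprod n) _.
- by move=> z; rewrite mule_ge0 ?lee_fin ?g0// prodr_ge0.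
rewrite /fubini_F /=.
under eq_integral => t _.
  rewrite ge0_integralZl//; last 3 first.
  - by apply/measurable_EFinP; exact: mprod.
  - by move=> x _; rewrite lee_fin prodr_ge0.
  - by rewrite lee_fin.
  rewrite IH.
  over.
rewrite ge0_integralZr//; last 3 first.
- by apply/measurable_EFinP.
- by move=> x _; rewrite lee_fin.
- rewrite lee_fin exprn_ge0// -lee_fin -gc; apply: integral_ge0 => t _.
  by rewrite lee_fin.
by rewrite gc -EFinM exprS.
Qed.

(** * Moments of a radial kernel *)

Lemma integral_oneDsqrV (R : realType) :
  (\int[lebesgue_measure]_t (oneDsqr t)^-1%:E = (pi : R)%:E)%E.
Proof.
have m1 D : measurable_fun D (fun t : R => (oneDsqr t)^-1).
  apply: measurable_funTS; apply: continuous_measurable_fun.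
  exact: continuous_oneDsqrV.
have p0 (t : R) : (0 <= ((oneDsqr t)^-1)%:E)%E.
  by rewrite lee_fin invr_ge0 (le_trans ler01)// oneDsqr_ge1.
have me D : measurable_fun D (fun t : R => ((oneDsqr t)^-1)%:E).
  by apply/measurable_EFinP; exact: m1.
have negE : (\int[lebesgue_measure]_(t in `]-oo, 0%R]) (oneDsqr t)^-1%:E =
    (pi / 2 : R)%:E)%E.
  rewrite -integral0y_oneDsqr ge0_integration_by_substitution0//.
  by apply: eq_integral => t _; rewrite /oneDsqr sqrrN.
rewrite -set_itvNyy (@itv_bndbnd_setU _ _ _ (BLeft 0%R))//.
rewrite ge0_integral_setU//=; last 2 first.
- exact: me.
- by apply: lt_disjoint => x y; rewrite !in_itv /= andbT => /lt_le_trans; exact.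
rewrite integral0y_oneDsqr integral_itv_bndo_bndc; last exact: me.
by rewrite negE -EFinD -splitr.
Qed.

Section radial_kernel_integrals.
Context {R : realType} {m : nat} (K : 'rV[R]_m -> R) (kappa : R -> R).
Hypothesis radialK : radial_kernel K kappa.
Local Notation mu := (borel_lebesgue m).

Let K0 x : 0 <= K x. Proof. by have [] := radialK. Qed.

Let kappa_ge0 t : 0 <= t -> 0 <= kappa t.
Proof. by have [_ _ _ [+ _] _] := radialK; exact. Qed.

Let kappa_ni t u : 0 <= t -> t <= u -> kappa u <= kappa t.
Proof. by have [_ _ _ [_ +] _] := radialK; exact. Qed.

Let mK : measurable_fun setT K := measurable_radial_kernel radialK.

Lemma integral_radial_kernel : (\int[mu]_x (K x)%:E = 1)%E.
Proof.
have [_ K1 _ _ _] := radialK.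
rewrite -K1 integral_leb//; first exact/measurable_EFinP.
by move=> x _; rewrite lee_fin.
Qed.

(** Since [x_i ^ 2 <= norm2 x ^ 2], the factor [1 / (1 + norm2 x ^ 2) ^ m] that
    dominates the integrand is at most the product of the [1 / (1 + x_i ^ 2)],
    which has integral [pi ^ m]. *)
Lemma radial_kernel_moment (s : R) : 0 <= s ->
  exists2 M : R, 0 <= M &
    (\int[mu]_x (K x * norm2 x `^ s)%:E <= M%:E)%E.
Proof.
move=> s0; have [A A0 kA] := exp_tail_le_oneDsqr m radialK s0.
have pos (t : R) : 0 < oneDsqr t by rewrite (lt_le_trans ltr01)// oneDsqr_ge1.
have mo : measurable_fun [set: R] (fun t : R => (oneDsqr t)^-1).
  by apply: continuous_measurable_fun; exact: continuous_oneDsqrV.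
have mprod : measurable_fun [set: 'rV[R]_m]
    (fun x => (\prod_(i < m) (oneDsqr (x ord0 i))^-1)%:E).
  apply/measurable_EFinP; apply: measurable_prod => i _.
  by apply: measurableT_comp mo _; exact: measurable_coord_rV.
have prod0 (x : 'rV[R]_m) : 0 <= \prod_(i < m) (oneDsqr (x ord0 i))^-1.
  by apply: prodr_ge0 => i _; rewrite invr_ge0 ltW.
exists (A * pi ^+ m); first by rewrite mulr_ge0// exprn_ge0// pi_ge0.
apply: (@le_trans _ _ (\int[mu]_x (A%:E *
    (\prod_(i < m) (oneDsqr (x ord0 i))^-1)%:E))%E); last first.
  rewrite ge0_integralZl//; last by move=> x _; rewrite lee_fin.
  have o0 (t : R) : 0 <= (oneDsqr t)^-1 by rewrite invr_ge0 ltW.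
  by rewrite (integral_prod_coord m mo o0 (integral_oneDsqrV R)) EFinM.
apply: ge0_le_integral => //.
- by move=> x _; rewrite lee_fin mulr_ge0// powR_ge0.
- apply/measurable_EFinP; apply: measurable_funM => //.
  exact: measurable_norm2_powR.
- by apply: measurable_funeM.
move=> x _; have [_ _ -> _ _] := radialK; rewrite -EFinM lee_fin.
apply: le_trans (kA _ (norm2_ge0 x)) _; rewrite ler_wpM2l// prodfV.
rewrite lef_pV2 ?posrE ?exprn_gt0 ?prodr_gt0//.
rewrite -[m in _ ^+ m]card_ord -prodr_const.
apply: ler_prod => i _; rewrite ltW//= /oneDsqr lerD2l.
by rewrite -real_normK ?num_real// lerXn2r ?nnegrE ?norm2_ge0// ler_coord_norm2.
Qed.

(** Otherwise the kernel would vanish off the origin, which is a null set in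
    positive dimension. *)
Lemma kappa_pos_near0 : (0 < m)%N -> exists2 a : R, 0 < a & 0 < kappa a.
Proof.
move=> m0; apply: contrapT => nopos.
have K00 x : ~ @cube R m 0 x -> K x = 0.
  move=> xn0; have [_ _ -> _ _] := radialK.
  apply/eqP; rewrite eq_le kappa_ge0 ?norm2_ge0// andbT.
  rewrite leNgt; apply/negP => kpos; apply: nopos; exists (norm2 x) => //.
  rewrite lt_neqAle norm2_ge0 andbT; apply/eqP => x0; apply: xn0 => i /=.
  by rewrite in_itv /= -ler_norml (le_trans (ler_coord_norm2 _ _))// -x0.
have mc : measurable (@cube R m 0) by exact: measurable_box.
suff : (1 <= 0 :> \bar R)%E by rewrite lee_fin ler10.
rewrite -[leLHS]integral_radial_kernel.
apply: (@le_trans _ _ (\int[mu]_(x in @cube R m 0) (kappa 0)%:E)%E); last first.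
  rewrite integral_cst//= borel_lebesgue_cube// mulr0 expr0n eqn0Ngt m0.
  by rewrite mule0.
rewrite [leRHS]integral_mkcond; apply: ge0_le_integral => //.
- by move=> x _; rewrite lee_fin.
- by apply/measurable_EFinP.
- apply/(measurable_restrictT _ _).1 => //.
move=> x _; rewrite patchE; case: ifPn => [_|/negP xn0].
  by rewrite lee_fin; exact: radial_kernel_le0.
by rewrite K00// => x0; apply: xn0; rewrite inE.
Qed.

Let mkappa (s : R) (D : set R) : measurable D -> D `<=` `[0, +oo[%classic ->
  measurable_fun D (fun t => (kappa t * t `^ s)%:E).
Proof.
move=> mD D0.
have mf : measurable_fun D (fun t : R => (kappa (Num.max 0 t) * t `^ s)%:E).
  apply/measurable_EFinP; apply: measurable_funM; last first.
    by apply: measurable_funTS; exact: measurable_powR.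
  apply: nonincreasing_measurable => // u v uv.
  apply: kappa_ni; first by rewrite le_max lexx.
  by rewrite ge_max !le_max lexx uv orbT.
apply: eq_measurable_fun mf => t /[!inE] /D0 /=; rewrite in_itv/= andbT => t0.
by rewrite max_r.
Qed.

(** Positivity also needs the integral to be finite, because the real-valued
    integral of a function with infinite integral is [0]. *)
Lemma kappa_moment_gt0 (s : R) : (0 < m)%N -> 0 <= s ->
  0 < \int[lebesgue_measure]_(t in `[0, +oo[) (kappa t * t `^ s).
Proof.
move=> m0 s0; rewrite /Rintegral; apply: fine_gt0; apply/andP; split.
  have [a a0 ka] := kappa_pos_near0 m0.
  apply: (@lt_le_trans _ _
      (\int[lebesgue_measure]_(t in `[(a / 2)%R, a]) (kappa a * (a / 2) `^ s)%:E)%E).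
    rewrite integral_cst//= lebesgue_measure_itv /= lte_fin.
    rewrite ifT; last by lra.
    rewrite -EFinD -EFinM lte_fin !mulr_gt0// ?powR_gt0//; lra.
  apply: (@le_trans _ _
      (\int[lebesgue_measure]_(t in `[(a / 2)%R, a]) (kappa t * t `^ s)%:E)%E).
    apply: ge0_le_integral => //.
    - by move=> t _; rewrite lee_fin mulr_ge0 ?powR_ge0// ltW.
    - apply: mkappa => // t /=; rewrite !in_itv /= andbT => /andP[ta _]; lra.
    move=> t /=; rewrite in_itv /= => /andP[at_ ta].
    rewrite lee_fin ler_pM ?powR_ge0//; first exact: ltW.
      by apply: kappa_ni => //; lra.
    by rewrite ge0_ler_powR// ?nnegrE//; lra.
  apply: ge0_subset_integral => //.
  - by apply: mkappa.
  - move=> t /=; rewrite in_itv/= andbT => t0.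
    by rewrite lee_fin mulr_ge0 ?powR_ge0// kappa_ge0.
  - move=> t /=; rewrite !in_itv /= andbT => /andP[ta _]; lra.
have [A A0 kA] := exp_tail_le_oneDsqr 1 radialK s0.
apply: (@le_lt_trans _ _
    (\int[lebesgue_measure]_(t in `[0%R, +oo[) (A%:E * (oneDsqr t)^-1%:E))%E).
  apply: ge0_le_integral => //.
  - move=> t /=; rewrite in_itv/= andbT => t0.
    by rewrite lee_fin mulr_ge0 ?powR_ge0// kappa_ge0.
  - by apply: mkappa.
  - apply: measurable_funeM; apply/measurable_EFinP; apply: measurable_funTS.
    by apply: continuous_measurable_fun; exact: continuous_oneDsqrV.
  move=> t /=; rewrite in_itv/= andbT => t0; rewrite -EFinM lee_fin.
  by have := kA t t0; rewrite expr1.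
rewrite ge0_integralZl//.
- by rewrite integral0y_oneDsqr -EFinM ltry.
- apply/measurable_EFinP; apply: measurable_funTS.
  by apply: continuous_measurable_fun; exact: continuous_oneDsqrV.
Qed.

(** This makes the half-width of the band at least a fixed multiple of
    [h `^ rho], the quantity against which the leaked mass is compared. *)
Lemma C1_gt0 (C rho : R) : (0 < m)%N -> 0 < C -> 0 < rho ->
  0 < C1 m kappa C rho.
Proof.
move=> m0 C0 rho0; rewrite /C1 mulr_gt0//; last first.
  by rewrite kappa_moment_gt0// addr_ge0// ltW.
rewrite mulr_gt0// /unit_ball_volume.
have mB : measurable [set x : 'rV[R]_m | norm2 x <= 1].
  rewrite (_ : mkset _ = @norm2 R m @^-1` `]-oo, 1]%classic).
    by rewrite -[X in measurable X]setTI; exact: measurable_norm2.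
  by apply/seteqP; split => x /=; rewrite in_itv.
have cm (r : R) : measurable (@cube R m r) by exact: measurable_box.
rewrite leb_borelE//; apply: fine_gt0; apply/andP; split.
  apply: (@lt_le_trans _ _ (mu (@cube R m m%:R^-1))).
    by rewrite borel_lebesgue_cube// lte_fin exprn_gt0// mulr_gt0// invr_gt0 ltr0n.
  apply: le_measure; rewrite ?inE// => x /= xm.
  rewrite (le_trans (norm2_le_cube (r := m%:R^-1) _ _))//.
    by move=> i; have /= := xm i; rewrite in_itv /= -ler_norml.
  by rewrite divff// pnatr_eq0 -lt0n.
apply: (@le_lt_trans _ _ (mu (@cube R m 1))); last first.
  by rewrite borel_lebesgue_cube// ltry.
apply: le_measure; rewrite ?inE// => x /= x1 i /=.
by rewrite in_itv /= -ler_norml (le_trans (ler_coord_norm2 _ _)).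
Qed.

Lemma C2_ge0 (U : R) : 0 <= C2 m kappa U.
Proof.
rewrite /C2 addr_ge0//; last by rewrite !mulr_ge0 ?sqr_ge0// kappa_ge0.
rewrite mulr_ge0//.
rewrite addr_ge0// /Rintegral fine_ge0//; apply: integral_ge0 => t /=.
rewrite in_itv/= andbT => t0.
by rewrite lee_fin mulr_ge0 ?powR_ge0// kappa_ge0.
Qed.

End radial_kernel_integrals.

(** * Densities and rescaled kernels *)

Section density.
Context d (T : measurableType d) (R : realType).
Variables (mu nu : {measure set T -> \bar R}) (p : T -> R).
Hypotheses (p0 : forall x, 0 <= p x) (mp : measurable_fun setT p).
Hypothesis nuE : forall A, measurable A ->
  nu A = (\int[mu]_(x in A) (p x)%:E)%E.
Import HBNNSimple.

Let density_nnsfun (h : {nnsfun T >-> R}) :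
  (\int[nu]_x (h x)%:E = \int[mu]_x ((h x)%:E * (p x)%:E))%E.
Proof.
rewrite integralT_nnsfun sintegralE.
transitivity (\int[mu]_x (\sum_(y \in range h)
    ((y * \1_(h @^-1` [set y]) x)%:E * (p x)%:E)))%E; last first.
  apply: eq_integral => x _; rewrite -ge0_mule_fsuml => [|y].
    by rewrite fsumEFin// -fimfunE.
  exact: nnfun_muleindic_ge0.
rewrite ge0_integral_fsum//; last 2 first.
- move=> y; apply: emeasurable_funM; last exact/measurable_EFinP.
  by apply/measurable_EFinP; apply: measurable_funM.
- move=> y x _; apply: mule_ge0; last by rewrite lee_fin.
  exact: nnfun_muleindic_ge0.
apply: eq_fsbigr => y; rewrite inE => -[x0 _ hx0].
have y0 : 0 <= y by rewrite -hx0.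
rewrite nuE// integral_mkcond -ge0_integralZl//; last 2 first.
- by apply/(measurable_restrictT _ _).1 => //; apply: measurable_funTS; exact/measurable_EFinP.
- by move=> x _; rewrite patchE; case: ifPn => // _; rewrite lee_fin.
apply: eq_integral => x _; rewrite patchE EFinM -muleA; congr (_ * _)%E.
by rewrite indicE; case: ifPn => _; rewrite ?mul1e ?mul0e.
Qed.

(** Both sides agree on indicators by assumption, hence on simple functions,
    hence on nonnegative functions by monotone convergence. *)
Lemma integral_density (g : T -> \bar R) : measurable_fun setT g ->
  (forall x, 0 <= g x)%E ->
  (\int[nu]_x g x = \int[mu]_x (g x * (p x)%:E))%E.
Proof.
move=> mg g0; pose h := nnsfun_approx measurableT mg.
transitivity (limn (fun n => \int[nu]_x (h n x)%:E)%E).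
  rewrite -monotone_convergence//.
  - apply: eq_integral => x _; apply/esym/cvg_lim => //.
    exact: cvg_nnsfun_approx.
  - by move=> n; exact/measurable_EFinP.
  - by move=> n x _; rewrite lee_fin.
  - by move=> x _ a b ab; rewrite lee_fin; exact/lefP/nd_nnsfun_approx.
under eq_fun do rewrite density_nnsfun.
rewrite -monotone_convergence//.
- apply: eq_integral => x _; apply/cvg_lim => //.
  apply: cvgeZr => //; exact: cvg_nnsfun_approx.
- by move=> n; apply: emeasurable_funM; exact/measurable_EFinP.
- by move=> n x _; rewrite mule_ge0 ?lee_fin.
- move=> x _ a b ab; rewrite lee_wpmul2r ?lee_fin//.
  exact/lefP/nd_nnsfun_approx.
Qed.

End density.

(** Such a function is continuous, so its strict superlevel sets are open. *)
Lemma holder_measurable (R : realType) m (C rho : R) (p : 'rV[R]_m -> R) :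
  0 < C -> 0 < rho -> holder C rho p -> measurable_fun setT p.
Proof.
move=> C0 rho0 pH.
apply: (measurability (@RGenOInfty.G R)) => [|_ [_ [c ->] <-]].
  exact: RGenOInfty.measurableE.
rewrite setTI preimage_itvoy; apply: open_measurable_rV.
rewrite openE => x /= cx.
(* the radius within which the Hoelder bound keeps [p] above [c] *)
pose e := ((p x - c) / C) `^ rho^-1.
have pc0 : 0 < p x - c by rewrite subr_gt0.
have e0 : 0 < e by rewrite powR_gt0// divr_gt0.
have me : 0 < e / m.+1%:R by rewrite divr_gt0.
apply/nbhs_ballP; exists (e / m.+1%:R) => //= y [_ xy].
have xye : norm2 (x - y) < e.
  apply: (le_lt_trans (norm2_le_cube (r := e / m.+1%:R) (ltW me) _)).
    by move=> i; rewrite !mxE; apply: ltW; exact: xy.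
  by rewrite mulrC mulrAC ltr_pdivrMr// ltr_pM2l// ltr_nat.
have : `|p x - p y| < p x - c.
  apply: (le_lt_trans (pH y x)).
  rewrite mulrC -ltr_pdivlMr//.
  apply: (@lt_le_trans _ _ (e `^ rho)).
    by rewrite gt0_ltr_powR// nnegrE ?norm2_ge0// ltW.
  by rewrite -powRrM mulVf ?gt_eqF// powRr1// ltW// divr_gt0.
by move=> /(le_lt_trans (ler_norm _)); rewrite ltrD2l ltrN2.
Qed.

Section scaled_kernel.
Context {R : realType} {m : nat} (K : 'rV[R]_m -> R) (kappa : R -> R).
Hypothesis radialK : radial_kernel K kappa.
Variable h : R.
Hypothesis h0 : 0 < h.
Local Notation mu := (borel_lebesgue m).

Definition kernel_at (x y : 'rV[R]_m) : R :=
  (h ^+ m)^-1 * K (h^-1 *: (x - y)).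

Lemma kernel_at_ge0 x y : 0 <= kernel_at x y.
Proof.
have [K0 _ _ _ _] := radialK.
by rewrite mulr_ge0// invr_ge0 exprn_ge0// ltW.
Qed.

Lemma kernel_at_le x y : kernel_at x y <= (h ^+ m)^-1 * kappa 0.
Proof.
rewrite ler_wpM2l ?invr_ge0 ?exprn_ge0 ?(ltW h0)//.
exact: radial_kernel_le0 radialK.
Qed.

(** Lets integrals in the second variable be reduced to integrals in the
    first, where the change of variables applies. *)
Lemma kernel_atC x y : kernel_at x y = kernel_at y x.
Proof.
by rewrite /kernel_at -(radial_kernelN _ radialK) -scalerN opprB.
Qed.

Let measurable_diff : measurable_fun [set: 'rV[R]_m * 'rV[R]_m]
  (fun z => z.1 - z.2 : 'rV[R]_m).
Proof.
apply/measurable_fun_rVP => i; under eq_fun do rewrite !mxE.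
apply: measurable_funB.
  exact: measurableT_comp (measurable_coord_rV i) measurable_fst.
exact: measurableT_comp (measurable_coord_rV i) measurable_snd.
Qed.

Lemma measurable_kernel_at :
  measurable_fun [set: 'rV[R]_m * 'rV[R]_m] (fun z => kernel_at z.1 z.2).
Proof.
apply: measurable_funM => //.
apply: measurableT_comp; first exact: measurable_radial_kernel radialK.
apply/measurable_fun_rVP => i; under eq_fun do rewrite !mxE.
apply: measurable_funM => //.
have := (measurable_fun_rVP _).1 measurable_diff i.
by under eq_fun do rewrite !mxE.
Qed.

Lemma measurable_norm2_diff (s : R) :
  measurable_fun [set: 'rV[R]_m * 'rV[R]_m] (fun z => norm2 (z.1 - z.2) `^ s).
Proof.
by have := measurableT_comp (measurable_norm2_powR s) measurable_diff.
Qed.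

Lemma measurable_kernel_atl y : measurable_fun setT (kernel_at ^~ y).
Proof. by have := measurable_fun_pair1 y measurable_kernel_at. Qed.

Lemma measurable_kernel_atr x : measurable_fun setT (kernel_at x).
Proof. by have := measurable_fun_pair2 x measurable_kernel_at. Qed.

Lemma measurable_norm2_diffl (s : R) y :
  measurable_fun setT (fun x : 'rV[R]_m => norm2 (x - y) `^ s).
Proof. by have := measurable_fun_pair1 y (measurable_norm2_diff s). Qed.

Let hm0 : 0 < h ^+ m. Proof. exact: exprn_gt0. Qed.

Lemma integral_kernel_at y : (\int[mu]_x (kernel_at x y)%:E = 1)%E.
Proof.
have [K0 _ _ _ _] := radialK.
have mK := measurable_radial_kernel radialK.
under eq_integral do rewrite EFinM.
rewrite ge0_integralZl//.
- rewrite (@integral_affine _ _ h y (EFin \o K) h0)//.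
  + by rewrite (integral_radial_kernel radialK) mule1 -EFinM mulVf// gt_eqF.
  + exact/measurable_EFinP.
- apply/measurable_EFinP.
  by have := measurableT_comp mK (measurable_affine h^-1 y).
- by move=> x _; rewrite lee_fin.
- by rewrite lee_fin invr_ge0 ltW.
Qed.

Lemma integral_kernel_at_moment (s M : R) y :
  (\int[mu]_x (K x * norm2 x `^ s)%:E <= M%:E)%E ->
  (\int[mu]_x (kernel_at x y * norm2 (x - y) `^ s)%:E <= (h `^ s * M)%:E)%E.
Proof.
move=> KM; have [K0 _ _ _ _] := radialK.
have mK := measurable_radial_kernel radialK.
pose G := fun u => (K u * norm2 u `^ s)%:E.
have mG : measurable_fun setT G.
  apply/measurable_EFinP; apply: measurable_funM => //.
  exact: measurable_norm2_powR.
have G0 u : (0 <= G u)%E by rewrite lee_fin mulr_ge0// powR_ge0.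
have kG x : (kernel_at x y * norm2 (x - y) `^ s)%:E =
    (((h ^+ m)^-1 * h `^ s)%:E * G (h^-1 *: (x - y)%R))%E.
  rewrite /kernel_at /G norm2Z ?invr_ge0 ?(ltW h0)//.
  rewrite powRM ?invr_ge0 ?(ltW h0) ?norm2_ge0//.
  rewrite -EFinM; congr EFin.
  have hs : h `^ s * h^-1 `^ s = 1.
    by rewrite -powRM ?invr_ge0 ?(ltW h0)// mulfV ?gt_eqF// powR1.
  rewrite [RHS](_ : _ = (h ^+ m)^-1 * K (h^-1 *: (x - y)) *
    (h `^ s * h^-1 `^ s) * norm2 (x - y) `^ s); last by ring.
  by rewrite hs mulr1.
under eq_integral do rewrite kG.
have c0 : (0 <= ((h ^+ m)^-1 * h `^ s)%:E)%E.
  by rewrite lee_fin mulr_ge0 ?powR_ge0// invr_ge0 ltW.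
rewrite ge0_integralZl//.
- rewrite (@integral_affine _ _ h y G h0)// muleA -EFinM.
  rewrite mulrAC mulVf ?gt_eqF// mul1r EFinM.
  by rewrite lee_wpmul2l// lee_fin powR_ge0.
- by have := measurableT_comp mG (measurable_affine h^-1 y).
Qed.

End scaled_kernel.

(** * Expectations over an independent sample *)

Section iid_sample_laws.
Context {R : realType} {m : nat} (p : 'rV[R]_m -> R).
Hypotheses (p0 : forall x, 0 <= p x) (mp : measurable_fun setT p).
Context d (Omega : measurableType d) (P : probability Omega R) (N : nat).
Variable s : 'I_N -> {RV P >-> 'rV[R]_m}.
Hypothesis iid : iid_sample p s.
Local Notation mu := (borel_lebesgue m).

Lemma sample_expectation i (g : 'rV[R]_m -> \bar R) :
  measurable_fun setT g -> (forall y, 0 <= g y)%E ->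
  (\int[P]_w g (s i w) = \int[mu]_y (g y * (p y)%:E))%E.
Proof.
move=> mg g0; rewrite -(integral_density (nu := distribution P (s i)))//.
  by rewrite ge0_integral_pushforward.
move=> A mA; apply: etrans (iid.1 i A mA) _; rewrite integral_leb//.
  by apply/measurable_EFinP; exact: measurable_funTS.
by move=> y _; rewrite lee_fin.
Qed.

(** The joint law of two distinct samples agrees with the product of their
    laws on rectangles, so the integral factors by Tonelli's theorem. *)
Lemma sample_expectation_prod i j (g g' : 'rV[R]_m -> \bar R) : i != j ->
  measurable_fun setT g -> (forall y, 0 <= g y)%E ->
  measurable_fun setT g' -> (forall y, 0 <= g' y)%E ->
  (\int[P]_w (g (s i w) * g' (s j w)) =
   \int[P]_w g (s i w) * \int[P]_w g' (s j w))%E.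
Proof.
move=> ij mg g0 mg' g'0.
have mpair : measurable_fun setT (fun w => (s i w, s j w)).
  exact: measurable_fun_pair.
have [nu nuE] := image_measure_exists P mpair.
have nuP A : measurable A ->
    ((distribution P (s i) \x distribution P (s j)) A = nu A)%E.
  apply: product_measure_unique => {}A B mA mB; rewrite nuE.
  (* constrain the samples [i] and [j], and leave the others free *)
  pose E k := if k == i then A else if k == j then B else setT.
  have mE k : measurable (E k) by rewrite /E; case: ifP => // _; case: ifP.
  have Ei : E i = A by rewrite /E eqxx.
  have Ej : E j = B by rewrite /E eqxx eq_sym (negbTE ij).
  have := iid.2 E mE.
  rewrite (bigD1 i)//= (bigD1 j) 1?eq_sym//= big1 ?mule1; last first.
    move=> k /andP[ki kj]; rewrite /E (negbTE ki) (negbTE kj) preimage_setT.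
    exact: probability_setT.
  rewrite Ei Ej => <-; congr (P _).
  apply/seteqP; split => w /=.
    move=> [Aw Bw] k _ /=; rewrite /E.
    by case: eqP => [->//|_]; case: eqP => [->//|].
  by move=> H; split; [have := H i I|have := H j I]; rewrite /= ?Ei ?Ej.
have mgg : measurable_fun setT (fun z : 'rV[R]_m * 'rV[R]_m => g z.1 * g' z.2)%E.
  by apply: emeasurable_funM; apply: measurableT_comp.
have gg0 (z : 'rV[R]_m * 'rV[R]_m) : (0 <= g z.1 * g' z.2)%E by rewrite mule_ge0.
transitivity (\int[pushforward P (fun w => (s i w, s j w))]_z (g z.1 * g' z.2))%E.
  by rewrite ge0_integral_pushforward.
transitivity (\int[(distribution P (s i) \x distribution P (s j))%E]_z
    (g z.1 * g' z.2))%E.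
  apply: eq_measure_integral => A mA _.
  exact: etrans (esym (nuE A)) (esym (nuP A mA)).
rewrite fubini_tonelli1//= /fubini_F /=.
have E' (k : 'I_N) f : measurable_fun setT f -> (forall y, 0 <= f y)%E ->
    (\int[P]_w f (s k w) = \int[distribution P (s k)]_y f y)%E.
  by move=> mf f0; rewrite ge0_integral_pushforward.
under eq_integral do rewrite ge0_integralZl// -E'//.
rewrite ge0_integralZr// -?E'//.
by apply: integral_ge0.
Qed.

End iid_sample_laws.

(** The squared bias plus the variance, where the variance of each term is
    bounded by its second moment, and [Y ^ 2 <= B * Y]. *)
Lemma mean_square_error_le (R : realType) d (Omega : measurableType d)
    (P : probability Omega R) (N : nat) (Y : 'I_N -> Omega -> R) (B b a : R) :
  (0 < N)%N -> 0 <= a -> (forall i, measurable_fun setT (Y i)) ->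
  (forall i w, 0 <= Y i w <= B) ->
  (forall i, \int[P]_w (Y i w)%:E = b%:E)%E ->
  (forall i j, i != j -> \int[P]_w (Y i w * Y j w)%:E = (b * b)%:E)%E ->
  (\int[P]_w ((N%:R^-1 * \sum_(i < N) Y i w - a) ^+ 2)%:E <=
   ((b - a) ^+ 2 + B * b / N%:R)%:E)%E.
Proof.
move=> N0 a0 mY YB EY EYY.
have Y0 i w : 0 <= Y i w by have /andP[] := YB i w.
have NR : 0 < N%:R :> R by rewrite ltr0n.
have NV : 0 <= N%:R^-1 :> R by rewrite invr_ge0 ltW.
have B0 : 0 <= B.
  by have /andP[Y1 Y2] := YB (Ordinal N0) point; exact: le_trans Y2.
have b0 : 0 <= b.
  by rewrite -lee_fin -(EY (Ordinal N0)); apply: integral_ge0 => w _; rewrite lee_fin.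
pose S w := N%:R^-1 * \sum_(i < N) Y i w.
have S0 w : 0 <= S w by rewrite mulr_ge0// sumr_ge0.
have mS : measurable_fun setT S.
  by apply: measurable_funM => //; apply: measurable_sum.
have ES : (\int[P]_w (S w)%:E = b%:E)%E.
  rewrite /S; under eq_integral do rewrite EFinM -sumEFin.
  rewrite ge0_integralZl//; last 2 first.
  - by apply: emeasurable_sum => i; exact/measurable_EFinP.
  - by move=> w _; apply: sume_ge0 => i _; rewrite lee_fin.
  rewrite ge0_integral_sum//; last 2 first.
  - by move=> i; exact/measurable_EFinP.
  - by move=> i w _; rewrite lee_fin.
  rewrite (eq_bigr (fun=> b%:E))// sumEFin sumr_const card_ord -EFinM.
  by congr EFin; rewrite -[b *+ N]mulr_natl mulrA mulVf ?mul1r// gt_eqF.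
have ES2 : (\int[P]_w (S w ^+ 2)%:E <= (b ^+ 2 + B * b / N%:R)%:E)%E.
  have S2 w : S w ^+ 2 =
      N%:R^-1 ^+ 2 * \sum_(i < N) \sum_(j < N) (Y i w * Y j w).
    rewrite /S exprMn; congr (_ * _).
    by rewrite expr2 big_distrlr.
  under eq_integral do rewrite S2 EFinM -sumEFin.
  rewrite ge0_integralZl//; last 2 first.
  - apply: emeasurable_sum => i; apply/measurable_EFinP.
    by apply: measurable_sum => j; exact: measurable_funM.
  - move=> w _; apply: sume_ge0 => i _; rewrite lee_fin sumr_ge0// => j _.
    exact: mulr_ge0.
  rewrite ge0_integral_sum//; last 2 first.
  - move=> i; apply/measurable_EFinP.
    by apply: measurable_sum => j; exact: measurable_funM.
  - by move=> i w _; rewrite lee_fin sumr_ge0// => j _; exact: mulr_ge0.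
  apply: (@le_trans _ _ ((N%:R^-1 ^+ 2)%:E *
      \sum_(i < N) (B * b + N%:R * b ^+ 2)%:E)%E).
    rewrite lee_wpmul2l ?lee_fin ?sqr_ge0//; apply: lee_sum => i _.
    under eq_integral do rewrite -sumEFin.
    rewrite ge0_integral_sum//; last 2 first.
    - by move=> j; apply/measurable_EFinP; exact: measurable_funM.
    - by move=> j w _; rewrite lee_fin; exact: mulr_ge0.
    rewrite (bigD1 i)//= EFinD leeD//.
      apply: (@le_trans _ _ (\int[P]_w (B%:E * (Y i w)%:E))%E).
        apply: ge0_le_integral => //.
        - by move=> w _; rewrite lee_fin mulr_ge0.
        - by apply/measurable_EFinP; exact: measurable_funM.
        - by apply: measurable_funeM; exact/measurable_EFinP.
        move=> w _; rewrite -EFinM lee_fin ler_wpM2r//.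
        by have /andP[] := YB i w.
      rewrite ge0_integralZl ?EY//; first exact/measurable_EFinP.
      by move=> w _; rewrite lee_fin.
    rewrite (eq_bigr (fun=> (b * b)%:E)); last first.
      by move=> j ji; rewrite EYY// eq_sym.
    apply: (@le_trans _ _ (\sum_(j < N) (b * b)%:E)%E).
      rewrite [leRHS](bigD1 i)//= leeDr// lee_fin mulr_ge0//.
    by rewrite sumEFin sumr_const card_ord -[_ * _ *+ N]mulr_natl expr2.
  rewrite sumEFin sumr_const card_ord -EFinM lee_fin -[(_ + _) *+ N]mulr_natl.
  rewrite le_eqVlt; apply/orP; left; apply/eqP; field.
  by rewrite gt_eqF.
(* the cross term is moved to the left so that every integrand is nonnegative *)
have sqE : (\int[P]_w ((S w - a) ^+ 2)%:E + (2 * a * b)%:E =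
    \int[P]_w (S w ^+ 2)%:E + (a ^+ 2)%:E)%E.
  have m2 (f : Omega -> R) : measurable_fun setT f ->
      measurable_fun setT (fun w : Omega => (f w ^+ 2)%:E : \bar R).
    by move=> mf; apply/measurable_EFinP; exact: measurable_funX.
  transitivity (\int[P]_w (((S w - a) ^+ 2)%:E + (2 * a)%:E * (S w)%:E))%E.
    rewrite ge0_integralD//.
    - rewrite ge0_integralZl ?ES ?EFinM// ?lee_fin ?mulr_ge0//.
        exact/measurable_EFinP.
      by move=> w _; rewrite lee_fin.
    - by move=> w _; rewrite lee_fin sqr_ge0.
    - by apply: m2; apply: measurable_funD.
    - by move=> w _; rewrite mule_ge0 ?lee_fin ?S0// mulr_ge0.
    - by apply: measurable_funeM; exact/measurable_EFinP.
  transitivity (\int[P]_w ((S w ^+ 2)%:E + (a ^+ 2)%:E))%E.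
    by apply: eq_integral => w _; rewrite -EFinM -!EFinD; congr EFin; ring.
  rewrite ge0_integralD//.
  - by rewrite integral_cst//= probability_setT mule1.
  - by move=> w _; rewrite lee_fin sqr_ge0.
  - exact: m2.
  - by move=> w _; rewrite lee_fin sqr_ge0.
have -> : (((b - a) ^+ 2 + B * b / N%:R)%:E =
    (b ^+ 2 + B * b / N%:R)%:E + (a ^+ 2)%:E - (2 * a * b)%:E)%E.
  by rewrite -!EFinD; congr EFin; ring.
by rewrite leeBrDr// sqE leeD2r.
Qed.

(** * Bias and leaked mass of the smoothed density *)

Section smoothed_density.
Context {R : realType} {m : nat} (K : 'rV[R]_m -> R) (kappa : R -> R).
Hypothesis radialK : radial_kernel K kappa.
Variable h : R.
Hypothesis h0 : 0 < h.
Variable p : 'rV[R]_m -> R.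
Hypotheses (p0 : forall x, 0 <= p x) (mp : measurable_fun setT p).
Local Notation mu := (borel_lebesgue m).
Hypothesis p1 : (\int[mu]_y (p y)%:E = 1)%E.
Local Notation k := (kernel_at K h).

(** The convolution of the density with the rescaled kernel, which is the
    expectation of the kernel density estimator. *)
Definition smoothed (x : 'rV[R]_m) : R := fine (\int[mu]_y (k x y * p y)%:E).

Let k0 x y : 0 <= k x y. Proof. exact: (kernel_at_ge0 radialK h0). Qed.

Let mkp : measurable_fun setT
  (fun z : 'rV[R]_m * 'rV[R]_m => (k z.1 z.2 * p z.2)%:E).
Proof.
apply/measurable_EFinP; apply: measurable_funM.
  exact: (measurable_kernel_at radialK).
by have := measurableT_comp mp (@measurable_snd _ _ 'rV[R]_m 'rV[R]_m).
Qed.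

Let mk x : measurable_fun setT (k x).
Proof. exact: (measurable_kernel_atr radialK). Qed.

Lemma smoothedE x : (\int[mu]_y (k x y * p y)%:E)%E = (smoothed x)%:E.
Proof.
rewrite /smoothed fineK// ge0_fin_numE; last first.
  by apply: integral_ge0 => y _; rewrite lee_fin mulr_ge0.
apply: (@le_lt_trans _ _ (\int[mu]_y (((h ^+ m)^-1 * kappa 0)%:E * (p y)%:E))%E).
  apply: ge0_le_integral => //.
  - by move=> y _; rewrite lee_fin mulr_ge0.
  - by apply/measurable_EFinP; exact: measurable_funM.
  - by apply: measurable_funeM; exact/measurable_EFinP.
  move=> y _; rewrite -EFinM lee_fin ler_wpM2r//.
  exact: kernel_at_le.
rewrite ge0_integralZl//.
- by rewrite p1 mule1 ltry.
- exact/measurable_EFinP.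
- by move=> y _; rewrite lee_fin.
- by rewrite lee_fin (le_trans (k0 0 0))//; exact: kernel_at_le.
Qed.

Lemma smoothed_ge0 x : 0 <= smoothed x.
Proof.
rewrite -lee_fin -smoothedE; apply: integral_ge0 => y _.
by rewrite lee_fin mulr_ge0.
Qed.

Lemma measurable_smoothed : measurable_fun setT smoothed.
Proof.
apply/measurable_EFinP.
have -> : EFin \o smoothed = fubini_F mu (fun z => (k z.1 z.2 * p z.2)%:E).
  by apply/funext => x; rewrite /= -smoothedE.
apply: measurable_fun_fubini_tonelli_F => // z.
by rewrite lee_fin mulr_ge0.
Qed.

Lemma integral_smoothed : (\int[mu]_x (smoothed x)%:E = 1)%E.
Proof.
under eq_integral do rewrite -smoothedE.
have := @fubini_tonelli _ _ _ _ _ mu mu _ mkp.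
rewrite /fubini_F /fubini_G /= => ->; last first.
  by move=> z; rewrite lee_fin mulr_ge0.
rewrite -p1; apply: eq_integral => y _.
under eq_integral do rewrite mulrC EFinM.
rewrite ge0_integralZl ?lee_fin//.
- by rewrite (integral_kernel_at radialK h0) mule1.
- by apply/measurable_EFinP; exact: (measurable_kernel_atl radialK).
- by move=> x _; rewrite lee_fin.
Qed.

Lemma integral_kernel_at_r x : (\int[mu]_y (k x y)%:E = 1)%E.
Proof.
under eq_integral do rewrite (kernel_atC radialK).
exact: (integral_kernel_at radialK h0).
Qed.

Section bias.
Variables C rho M : R.
Hypotheses (C0 : 0 < C) (pH : holder C rho p).
Hypothesis KM : (\int[mu]_x (K x * norm2 x `^ rho)%:E <= M%:E)%E.

Let mkn x : measurable_fun setT (fun y => k x y * norm2 (x - y) `^ rho).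
Proof.
apply: measurable_funM => //.
by have := measurable_fun_pair2 x (@measurable_norm2_diff R m rho).
Qed.

Let integral_kn x :
  (\int[mu]_y (k x y * norm2 (x - y) `^ rho)%:E <= (h `^ rho * M)%:E)%E.
Proof.
under eq_integral do rewrite (kernel_atC radialK) -norm2N opprB.
exact: (integral_kernel_at_moment radialK h0).
Qed.

(** Averages against the kernel, which has mass [1], of two functions that
    differ by at most [C * norm2 (x - y) `^ rho]; the bias bound uses it twice,
    with [p] and its value at [x] exchanged. *)
Let shift_le (u v : 'rV[R]_m -> R) x : (forall y, 0 <= u y) ->
  (forall y, 0 <= v y) -> measurable_fun setT u -> measurable_fun setT v ->
  (forall y, u y <= v y + C * norm2 (x - y) `^ rho) ->
  (\int[mu]_y (k x y * u y)%:E <=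
   \int[mu]_y (k x y * v y)%:E + (C * (h `^ rho * M))%:E)%E.
Proof.
move=> u0 v0 mu_ mv uv.
apply: (@le_trans _ _ (\int[mu]_y ((k x y * v y)%:E +
   C%:E * (k x y * norm2 (x - y) `^ rho)%:E))%E).
  apply: ge0_le_integral => //.
  - by move=> y _; rewrite lee_fin mulr_ge0.
  - by apply/measurable_EFinP; exact: measurable_funM.
  - apply: emeasurable_funD; first by apply/measurable_EFinP; exact: measurable_funM.
    by apply: measurable_funeM; apply/measurable_EFinP; exact: mkn.
  move=> y _; rewrite -EFinM -EFinD lee_fin.
  by rewrite mulrCA -mulrDr ler_wpM2l.
rewrite ge0_integralD//; last 4 first.
- by move=> y _; rewrite lee_fin mulr_ge0.
- by apply/measurable_EFinP; exact: measurable_funM.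
- by move=> y _; rewrite mule_ge0 ?lee_fin ?(ltW C0)// mulr_ge0// powR_ge0.
- by apply: measurable_funeM; apply/measurable_EFinP; exact: mkn.
rewrite leeD2l// ge0_integralZl//.
- by rewrite EFinM lee_wpmul2l ?lee_fin ?(ltW C0)//; exact: integral_kn.
- by apply/measurable_EFinP; exact: mkn.
- by move=> y _; rewrite lee_fin mulr_ge0// powR_ge0.
- by rewrite lee_fin ltW.
Qed.

Lemma smoothed_bias x : `|smoothed x - p x| <= C * (h `^ rho * M).
Proof.
have kpx : (\int[mu]_y (k x y * p x)%:E = (p x)%:E)%E.
  under eq_integral do rewrite mulrC EFinM.
  rewrite ge0_integralZl ?lee_fin//.
  - by rewrite integral_kernel_at_r mule1.
  - exact/measurable_EFinP.
  - by move=> y _; rewrite lee_fin.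
rewrite ler_distl; apply/andP; split.
  rewrite lerBlDr -lee_fin EFinD -smoothedE -[X in (X <= _)%E]kpx.
  apply: (@shift_le (fun=> p x) p) => // y.
  by have := pH y x; rewrite ler_distl => /andP[].
rewrite -lee_fin EFinD -smoothedE -[X in (_ <= X + _)%E]kpx.
apply: (@shift_le p (fun=> p x)) => // y.
by have := pH y x; rewrite ler_distl lerBlDr => /andP[].
Qed.

(** In the collar [V `\` Xi] the density vanishes, so the smoothed density is
    at most the bias bound. Beyond [V] the kernel only sees points of [Xi] at
    distance at least [eta], where inserting the factor
    [(norm2 (x - y) / eta) `^ q >= 1] turns the integral into a moment of
    order [q] of the kernel. With [q > rho] the last term is negligible
    against [h `^ rho]. *)
Lemma smoothed_leak (Xi V : set 'rV[R]_m) (eta q Mq : R) :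
  measurable Xi -> measurable V -> (forall y, ~ Xi y -> p y = 0) ->
  Xi `<=` V -> 0 < eta -> 0 <= q ->
  (forall x y, ~ V x -> Xi y -> eta <= norm2 (x - y)) ->
  (\int[mu]_x (K x * norm2 x `^ q)%:E <= Mq%:E)%E ->
  (\int[mu]_(x in ~` Xi) (smoothed x)%:E <=
   (C * (h `^ rho * M))%:E * mu (V `\` Xi) + ((eta `^ q)^-1 * (h `^ q * Mq))%:E)%E.
Proof.
move=> mXi mV pXi XiV eta0 q0 Vfar KMq.
have mb D : measurable_fun D (fun x => (smoothed x)%:E).
  by apply/measurable_EFinP; apply: measurable_funTS; exact: measurable_smoothed.
have mVX : measurable (V `\` Xi) by exact: measurableD.
have -> : ~` Xi = (V `\` Xi) `|` ~` V.
  apply/seteqP; split => [x nXi|x [[]//|nV] /XiV//].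
  by have [Vx|nVx] := pselect (V x); [left|right].
rewrite ge0_integral_setU//; last 3 first.
- exact: measurableC.
- by move=> x _; rewrite lee_fin smoothed_ge0.
- by apply/disj_setPS => x [[Vx _]].
apply: leeD.
  rewrite -integral_cst//; apply: ge0_le_integral => //.
  - by move=> x _; rewrite lee_fin smoothed_ge0.
  move=> x [_ nXi]; rewrite lee_fin.
  have := smoothed_bias x; rewrite (pXi x nXi) subr0.
  by apply: le_trans; rewrite ler_norm.
have etaq : 0 < eta `^ q by rewrite powR_gt0.
pose G (z : 'rV[R]_m * 'rV[R]_m) : \bar R :=
  ((k z.1 z.2 * norm2 (z.1 - z.2) `^ q) * p z.2)%:E.
have mG : measurable_fun setT G.
  apply/measurable_EFinP; apply: measurable_funM.
    apply: measurable_funM; first exact: (measurable_kernel_at radialK).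
    exact: measurable_norm2_diff.
  by have := measurableT_comp mp (@measurable_snd _ _ 'rV[R]_m 'rV[R]_m).
have G0 z : (0 <= G z)%E.
  by rewrite /G lee_fin mulr_ge0 ?p0// mulr_ge0 ?k0// powR_ge0.
have mGx x : measurable_fun setT (fun y => G (x, y)).
  exact: measurableT_comp mG _.
apply: (@le_trans _ _ (\int[mu]_x (((eta `^ q)^-1)%:E * \int[mu]_y G (x, y)))%E).
  rewrite [leLHS]integral_mkcond; apply: ge0_le_integral => //.
  - by move=> x _; rewrite erestrict_ge0// => ? _; rewrite lee_fin smoothed_ge0.
  - by apply/(measurable_restrictT _ _).1 => //; exact: measurableC.
  - by apply: measurable_funeM; exact: measurable_fun_fubini_tonelli_F.
  move=> x _; rewrite patchE; case: ifPn => [|_]; last first.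
    by rewrite mule_ge0 ?lee_fin ?invr_ge0 ?(ltW etaq)//; exact: integral_ge0.
  rewrite inE => nVx; rewrite -smoothedE -ge0_integralZl//; last first.
    by rewrite lee_fin invr_ge0 ltW.
  apply: ge0_le_integral => //.
  - by move=> y _; rewrite lee_fin mulr_ge0.
  - by have := measurable_fun_pair2 x mkp.
  - exact: measurable_funeM.
  move=> y _; rewrite -EFinM lee_fin /=.
  have [Xiy|/pXi ->] := pselect (Xi y); last by rewrite !mulr0.
  rewrite mulrA ler_wpM2r// mulrCA ler_peMr// mulrC ler_pdivlMr// mul1r.
  by rewrite ge0_ler_powR ?nnegrE ?norm2_ge0 ?(ltW eta0)// Vfar.
rewrite ge0_integralZl//; last 3 first.
- exact: measurable_fun_fubini_tonelli_F.
- by move=> x _; exact: integral_ge0.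
- by rewrite lee_fin invr_ge0 ltW.
rewrite EFinM lee_wpmul2l ?lee_fin ?invr_ge0 ?(ltW etaq)//.
have := @fubini_tonelli _ _ _ _ _ mu mu _ mG G0.
rewrite /fubini_F /fubini_G /= => ->.
apply: (@le_trans _ _ (\int[mu]_y ((h `^ q * Mq)%:E * (p y)%:E))%E); last first.
  rewrite ge0_integralZl//.
  - by rewrite p1 mule1.
  - exact/measurable_EFinP.
  - by move=> y _; rewrite lee_fin.
  - apply: le_trans (integral_kernel_at_moment radialK h0 0 KMq).
    by apply: integral_ge0 => y _; rewrite lee_fin mulr_ge0// powR_ge0.
have Mq0 : (0 <= (h `^ q * Mq)%:E)%E.
  apply: le_trans (integral_kernel_at_moment radialK h0 0 KMq).
  by apply: integral_ge0 => y _; rewrite lee_fin mulr_ge0// powR_ge0.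
apply: ge0_le_integral => //.
- by move=> y _; exact: integral_ge0.
- exact: measurable_fun_fubini_tonelli_G.
- by apply: measurable_funeM; exact/measurable_EFinP.
move=> y _; rewrite /G /=.
under eq_integral do rewrite mulrC EFinM.
rewrite ge0_integralZl ?lee_fin//.
- rewrite muleC lee_wpmul2r ?lee_fin//.
  exact: (integral_kernel_at_moment radialK h0).
- apply/measurable_EFinP; apply: measurable_funM.
    exact: (measurable_kernel_atl radialK).
  exact: measurable_norm2_diffl.
- by move=> x _; rewrite lee_fin mulr_ge0// powR_ge0.
Qed.

End bias.
End smoothed_density.

(** * Mean errors of the kernel density estimator *)

Lemma tonelli_on d1 d2 (T1 : measurableType d1) (T2 : measurableType d2)
    (R : realType) (m1 : {sigma_finite_measure set T1 -> \bar R})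
    (m2 : {sigma_finite_measure set T2 -> \bar R}) (D : set T2)
    (G : T1 * T2 -> \bar R) :
  measurable D -> measurable_fun setT G -> (forall z, 0 <= G z)%E ->
  measurable_fun setT (fun x => \int[m2]_(y in D) G (x, y))%E /\
  (\int[m1]_x \int[m2]_(y in D) G (x, y) =
   \int[m2]_(y in D) \int[m1]_x G (x, y))%E.
Proof.
move=> mD mG G0.
pose G' z := (G z * (\1_D z.2)%:E)%E.
have mG' : measurable_fun setT G'.
  apply: emeasurable_funM => //; apply/measurable_EFinP.
  by have := measurableT_comp (@measurable_indic _ T2 R setT D mD)
    (@measurable_snd _ _ T1 T2).
have G'0 z : (0 <= G' z)%E by rewrite mule_ge0// lee_fin.
have GE x : (\int[m2]_(y in D) G (x, y) = \int[m2]_y G' (x, y))%E.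
  by rewrite integral_mkcond; apply: eq_integral => y _; rewrite epatch_indic.
split.
  under eq_fun do rewrite GE.
  exact: measurable_fun_fubini_tonelli_F.
transitivity (\int[m1]_x \int[m2]_y G' (x, y))%E.
  by apply: eq_integral => x _; exact: GE.
rewrite (fubini_tonelli _ mG' G'0).
rewrite [RHS]integral_mkcond; apply: eq_integral => y _.
rewrite epatch_indic /G' /= ge0_integralZr//.
by have := measurable_fun_pair1 y mG.
Qed.

(** Markov's inequality in the form in which it is used: [t] is the failure
    probability that is allowed. *)
Lemma markov_ge0 d (T : measurableType d) (R : realType)
    (P : probability T R) (g : T -> \bar R) (c t : R) :
  0 < c -> measurable_fun setT g -> (forall w, 0 <= g w)%E ->
  (\int[P]_w g w <= (t * c)%:E)%E ->
  (P [set w | ~ (g w <= c%:E)] <= t%:E)%E.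
Proof.
move=> c0 mg g0 gt.
have mcg : measurable [set w | (c%:E <= g w)%E].
  by rewrite -[X in measurable X]setTI; apply: emeasurable_fun_c_infty.

apply: (@le_trans _ _ (P [set w | c%:E <= g w]%E)).
  apply: le_measure; rewrite ?inE//.
    rewrite (_ : mkset _ = [set w | (c%:E < g w)%E]).
      by rewrite -[X in measurable X]setTI; apply: emeasurable_fun_o_infty.
    by apply/seteqP; split => w /=; rewrite ltNge => /negP.
  by move=> w /= /negP; rewrite -ltNge => /ltW.
rewrite -(@lee_pmul2l _ c%:E)// -EFinM mulrC; apply: le_trans gt.
have := le_integral_abse P measurableT mg c0.
rewrite setTI; under eq_integral do rewrite gee0_abs//.
apply: le_trans; rewrite lee_wpmul2l ?lee_fin ?(ltW c0)//.
rewrite (_ : [set x | _] = [set w | (c%:E <= g w)%E])//.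
by apply/seteqP; split => w /=; rewrite gee0_abs.
Qed.

Section kde_errors.
Context {R : realType} {m : nat} (K : 'rV[R]_m -> R) (kappa : R -> R).
Hypothesis radialK : radial_kernel K kappa.
Variable h : R.
Hypothesis h0 : 0 < h.
Variable p : 'rV[R]_m -> R.
Hypotheses (p0 : forall x, 0 <= p x) (mp : measurable_fun setT p).
Local Notation mu := (borel_lebesgue m).
Hypothesis p1 : (\int[mu]_y (p y)%:E = 1)%E.
Local Notation k := (kernel_at K h).
Variable N : nat.
Hypothesis N0 : (0 < N)%N.

Let k0 x y : 0 <= k x y. Proof. exact: (kernel_at_ge0 radialK h0). Qed.

Let NV : 0 <= N%:R^-1 :> R. Proof. by rewrite invr_ge0. Qed.

Lemma kdeE (t : 'I_N -> 'rV[R]_m) x :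
  kde K h t x = N%:R^-1 * \sum_(i < N) k x (t i).
Proof. by []. Qed.

Lemma kde_ge0 (t : 'I_N -> 'rV[R]_m) x : 0 <= kde K h t x.
Proof. by rewrite kdeE mulr_ge0// sumr_ge0. Qed.

Lemma measurable_kde (t : 'I_N -> 'rV[R]_m) : measurable_fun setT (kde K h t).
Proof.
apply: measurable_funM => //; apply: measurable_sum => i.
exact: (measurable_kernel_atl radialK).
Qed.

Lemma integral_kde (t : 'I_N -> 'rV[R]_m) : (\int[mu]_x (kde K h t x)%:E = 1)%E.
Proof.
have mk i : measurable_fun setT (fun x => (k x (t i))%:E).
  by apply/measurable_EFinP; exact: (measurable_kernel_atl radialK).
under eq_integral do rewrite kdeE EFinM -sumEFin.
rewrite ge0_integralZl//; last 2 first.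
- exact: emeasurable_sum.
- by move=> x _; apply: sume_ge0 => i _; rewrite lee_fin.
rewrite ge0_integral_sum//; last by move=> i x _; rewrite lee_fin.
rewrite (eq_bigr (fun=> 1%:E)); last first.
  by move=> i _; rewrite (integral_kernel_at radialK h0).
rewrite sumEFin sumr_const card_ord -EFinM mulVf// pnatr_eq0 -lt0n.
exact: N0.
Qed.

Context d (Omega : measurableType d) (P : probability Omega R).
Variable s : 'I_N -> {RV P >-> 'rV[R]_m}.
Hypothesis iid : iid_sample p s.
Local Notation est w := (kde K h (fun i => s i w)).

Lemma measurable_kde_sample :
  measurable_fun setT (fun z : Omega * 'rV[R]_m => est z.1 z.2).
Proof.
apply: measurable_funM => //; apply: measurable_sum => i.
have mz : measurable_fun setT (fun z : Omega * 'rV[R]_m => (z.2, s i z.1)).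
  apply: measurable_fun_pair => //.
  exact: measurableT_comp (measurable_funPT (s i)) measurable_fst.
by have := measurableT_comp (measurable_kernel_at radialK h) mz.
Qed.

Let expectation_kernel_at i x :
  (\int[P]_w (k x (s i w))%:E = (smoothed K h p x)%:E)%E.
Proof.
rewrite -(smoothedE radialK h0)//.
rewrite (sample_expectation p0 mp iid i (g := fun y => (k x y)%:E))//.
- by apply/measurable_EFinP; exact: (measurable_kernel_atr radialK).
- by move=> y; rewrite lee_fin.
Qed.

Lemma expectation_kde x : (\int[P]_w (est w x)%:E = (smoothed K h p x)%:E)%E.
Proof.
have mk i : measurable_fun setT (fun w => (k x (s i w))%:E).
  apply/measurable_EFinP.
  exact: measurableT_comp (measurable_kernel_atr radialK h x) _.
under eq_integral do rewrite kdeE EFinM -sumEFin.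
rewrite ge0_integralZl//; last 2 first.
- exact: emeasurable_sum.
- by move=> w _; apply: sume_ge0 => i _; rewrite lee_fin.
rewrite ge0_integral_sum//; last by move=> i w _; rewrite lee_fin.
rewrite (eq_bigr (fun=> (smoothed K h p x)%:E)); last first.
  by move=> i _; exact: expectation_kernel_at.
rewrite sumEFin sumr_const card_ord -EFinM -[smoothed K h p x *+ N]mulr_natl mulrA mulVf ?mul1r//.
by rewrite pnatr_eq0 -lt0n N0.
Qed.

Let mean_square_kde x (a : R) : 0 <= a ->
  (\int[P]_w ((est w x - a) ^+ 2)%:E <=
   ((smoothed K h p x - a) ^+ 2 +
    (h ^+ m)^-1 * kappa 0 * smoothed K h p x / N%:R)%:E)%E.
Proof.
move=> a0.
apply: (@mean_square_error_le _ _ _ _ _ (fun i w => k x (s i w))) => //.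
- by move=> i; exact: measurableT_comp (measurable_kernel_atr radialK h x) _.
- by move=> i w; rewrite k0 kernel_at_le.
move=> i j ij; under eq_integral do rewrite EFinM.
have mk : measurable_fun setT (fun y => (k x y)%:E).
  by apply/measurable_EFinP; exact: (measurable_kernel_atr radialK h).
have kk y : (0 <= (k x y)%:E)%E by rewrite lee_fin.
by rewrite (sample_expectation_prod iid ij mk kk mk kk) !expectation_kernel_at.
Qed.

(** Pointwise, the squared bias plus a variance proportional to the smoothed
    density over [N * h ^+ m], where the smoothed density has integral [1]. *)
Lemma expected_square_error (Xi : set 'rV[R]_m) (C rho M : R) :
  measurable Xi -> 0 < C -> holder C rho p ->
  (\int[mu]_x (K x * norm2 x `^ rho)%:E <= M%:E)%E ->
  measurable_fun setT (fun w =>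
    \int[mu]_(x in Xi) ((est w x - p x) ^+ 2)%:E)%E /\
  (\int[P]_w \int[mu]_(x in Xi) ((est w x - p x) ^+ 2)%:E <=
   ((C * (h `^ rho * M)) ^+ 2)%:E * mu Xi + (kappa 0 / (N%:R * h ^+ m))%:E)%E.
Proof.
move=> mXi C0 pH KM.
have mb D : measurable_fun D (smoothed K h p).
  by apply: measurable_funTS; exact: (measurable_smoothed radialK h0).
have b0 x := smoothed_ge0 radialK h0 p0 mp p1 x.
have B0 : 0 <= kappa 0.
  have [_ _ _ [kappa0 _] _] := radialK; exact: kappa0.
have hm0 : 0 < h ^+ m by rewrite exprn_gt0.
pose G (z : Omega * 'rV[R]_m) := ((est z.1 z.2 - p z.2) ^+ 2)%:E.
have mG : measurable_fun setT G.
  apply/measurable_EFinP; apply: measurable_funX; apply: measurable_funB.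
    exact: measurable_kde_sample.
  by have := measurableT_comp mp (@measurable_snd _ _ Omega 'rV[R]_m).
have G0 z : (0 <= G z)%E by rewrite lee_fin sqr_ge0.
have [mGI GI] := tonelli_on P mu mXi mG G0.
split => //; rewrite [leLHS]GI.
pose c := (h ^+ m)^-1 * kappa 0 / N%:R.
have c0 : 0 <= c by rewrite !mulr_ge0// invr_ge0 ltW.
apply: (@le_trans _ _ (\int[mu]_(x in Xi)
    (((C * (h `^ rho * M)) ^+ 2)%:E + c%:E * (smoothed K h p x)%:E))%E).
  apply: ge0_le_integral => //.
  - by move=> x _; apply: integral_ge0.
  - apply: measurable_funTS; exact: measurable_fun_fubini_tonelli_G.
  - apply: emeasurable_funD => //.
    by apply: measurable_funeM; exact/measurable_EFinP.
  move=> x _; apply: (le_trans (mean_square_kde x (p0 x))).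
  rewrite -EFinM -EFinD lee_fin lerD//.
    rewrite -real_normK ?num_real//.
    apply: lerXn2r; rewrite ?nnegrE//.
      exact: le_trans (normr_ge0 _) (smoothed_bias radialK h0 p0 mp p1 C0 pH KM x).
    exact: (smoothed_bias radialK h0 p0 mp p1 C0 pH KM).
  by rewrite /c mulrAC.
rewrite ge0_integralD//; last 3 first.
- by move=> x _; rewrite lee_fin sqr_ge0.
- by move=> x _; rewrite mule_ge0 ?lee_fin.
- by apply: measurable_funeM; exact/measurable_EFinP.
apply: leeD; first by rewrite integral_cst.
rewrite ge0_integralZl//; last 2 first.
- exact/measurable_EFinP.
- by move=> x _; rewrite lee_fin.
apply: (@le_trans _ _ (c%:E * \int[mu]_x (smoothed K h p x)%:E)%E).
  rewrite lee_wpmul2l ?lee_fin//; apply: ge0_subset_integral => //.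
  - exact/measurable_EFinP.
  - by move=> x _; rewrite lee_fin.
rewrite (integral_smoothed radialK h0)// mule1 lee_fin /c le_eqVlt.
apply/orP; left; apply/eqP; field.
by rewrite pnatr_eq0 -lt0n N0 gt_eqF.
Qed.

Lemma expected_leak (Xi : set 'rV[R]_m) : measurable Xi ->
  measurable_fun setT (fun w => \int[mu]_(x in ~` Xi) (est w x)%:E)%E /\
  (\int[P]_w \int[mu]_(x in ~` Xi) (est w x)%:E =
   \int[mu]_(x in ~` Xi) (smoothed K h p x)%:E)%E.
Proof.
move=> mXi.
have mG : measurable_fun setT (fun z : Omega * 'rV[R]_m => (est z.1 z.2)%:E).
  by apply/measurable_EFinP; exact: measurable_kde_sample.
have G0 (z : Omega * 'rV[R]_m) : (0 <= (est z.1 z.2)%:E)%E.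
  by rewrite lee_fin kde_ge0.
have [mGI GI] := tonelli_on P mu (measurableC mXi) mG G0.
split => //; rewrite [LHS]GI.
by apply: eq_integral => x _; exact: expectation_kde.
Qed.

End kde_errors.

(** * The ambiguity set and its costs *)

Lemma integral_absB_le d (T : measurableType d) (R : realType)
    (mu : {measure set T -> \bar R}) (D : set T) (p q g : T -> R) :
  measurable D -> measurable_fun setT p -> measurable_fun setT q ->
  measurable_fun setT g -> (forall x, D x -> `|p x - q x| <= g x) ->
  (\int[mu]_(x in D) `|p x - q x|%:E <= \int[mu]_(x in D) (g x)%:E)%E.
Proof.
move=> mD mp mq mg pqg; apply: ge0_le_integral => //.
- apply/measurable_EFinP; apply: measurable_funTS.
  by apply: measurableT_comp => //; apply: measurable_funB.
- by apply/measurable_EFinP; exact: measurable_funTS.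
Qed.

Section ambiguity.
Context {R : realType} {m : nat} (K : 'rV[R]_m -> R) (kappa : R -> R).
Hypothesis radialK : radial_kernel K kappa.
Variable h : R.
Hypothesis h0 : 0 < h.
Variables (N : nat) (t : 'I_N -> 'rV[R]_m).
Hypothesis N0 : (0 < N)%N.
Local Notation mu := (borel_lebesgue m).
Variables (Xi : set 'rV[R]_m) (v delta : R).
Hypotheses (mXi : measurable Xi) (muXi : mu Xi = v%:E) (delta0 : 0 <= delta).

Let integral_cst_Xi (c : R) : (\int[mu]_(x in Xi) c%:E = (c * v)%:E)%E.
Proof. by rewrite integral_cst// [X in (_ * X)%E](_ : _ = v%:E). Qed.

Let est := kde K h t.
Let est0 x : 0 <= est x. Proof. exact: (kde_ge0 radialK h0). Qed.
Let mest D : measurable_fun D est.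
Proof. by apply: measurable_funTS; exact: (measurable_kde radialK). Qed.

(** The lower edge of the band lies below the estimator, so it integrates to at
    most [1]. The upper edge integrates over [Xi] to the mass of the estimator
    on [Xi] plus [delta * v], which is at least [1] exactly when the mass off
    [Xi] is at most [delta * v]. A convex combination of the two edges then
    has integral [1]. *)
Lemma ambiguity_set_nonempty :
  (\int[mu]_(x in ~` Xi) (est x)%:E <= (delta * v)%:E)%E ->
  ambiguity_set K Xi delta h t !=set0.
Proof.
move=> leak.
have mXiC : measurable (~` Xi) by exact: measurableC.
pose l := band_lower K delta h t; pose u := band_upper K delta h t.
have l0 x : 0 <= l x by rewrite /l /band_lower le_max lexx.
have lest x : l x <= est x.
  by rewrite /l /band_lower ge_max est0 lerBlDr lerDl.
have estu x : est x <= u x by rewrite /u /band_upper lerDl.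
have u0 x : 0 <= u x by exact: le_trans (estu x).
have mu_ D : measurable_fun D u.
  by rewrite /u /band_upper; apply: measurable_funD.
have ml D : measurable_fun D l.
  by rewrite /l /band_lower; apply: measurable_maxr => //; apply: measurable_funB.
have split1 : (\int[mu]_(x in Xi) (est x)%:E +
    \int[mu]_(x in ~` Xi) (est x)%:E = 1)%E.
  rewrite -ge0_integral_setU//.
  - by rewrite setUv (integral_kde radialK h0).
  - by apply/measurable_EFinP.
  - by move=> x _; rewrite lee_fin.
  - by apply/disj_setPCl.
have I0 D f : (forall x, 0 <= f x) -> (0 <= \int[mu]_(x in D) (f x)%:E)%E.
  by move=> f0; apply: integral_ge0 => x _; rewrite lee_fin.
have [a aE] : exists a : R, (\int[mu]_(x in Xi) (est x)%:E = a%:E)%E.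
  exists (fine (\int[mu]_(x in Xi) (est x)%:E)%E).
  rewrite fineK// ge0_fin_numE ?I0//.
  apply: (@le_lt_trans _ _ 1%E); last by rewrite ltry.
  by rewrite -[leRHS]split1 leeDl// I0.
have [c cE] : exists c : R, (\int[mu]_(x in ~` Xi) (est x)%:E = c%:E)%E.
  exists (fine (\int[mu]_(x in ~` Xi) (est x)%:E)%E).
  rewrite fineK// ge0_fin_numE ?I0//.
  by apply: le_lt_trans leak _; rewrite ltry.
have ac : a + c = 1 by have := split1; rewrite aE cE -EFinD => -[].
have cd : c <= delta * v by rewrite -lee_fin -cE.
have c0 : 0 <= c by rewrite -lee_fin -cE; exact: I0.
have uE : (\int[mu]_(x in Xi) (u x)%:E = (a + delta * v)%:E)%E.
  rewrite /u /band_upper; under eq_integral do rewrite EFinD.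
  rewrite ge0_integralD//.
  - by rewrite integral_cst_Xi -/est aE -EFinD.
  - by move=> x _; rewrite lee_fin est0.
  - by apply/measurable_EFinP; exact: mest.
have [b [bE ba]] : exists b : R,
    (\int[mu]_(x in Xi) (l x)%:E = b%:E)%E /\ b <= a.
  have la : (\int[mu]_(x in Xi) (l x)%:E <= a%:E)%E.
    rewrite -aE; apply: ge0_le_integral => //.
    - by move=> x _; rewrite lee_fin.
    - exact/measurable_EFinP.
    - exact/measurable_EFinP.
    by move=> x _; rewrite lee_fin.
  have fl : (\int[mu]_(x in Xi) (l x)%:E \is a fin_num)%E.
    by rewrite ge0_fin_numE ?I0// (le_lt_trans la)// ltry.
  exists (fine (\int[mu]_(x in Xi) (l x)%:E)%E); split; first by rewrite fineK.
  by rewrite -lee_fin fineK.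
have [lam lam01 lamE] : exists2 lam : R, 0 <= lam <= 1 &
    (1 - lam) * b + lam * (a + delta * v) = 1.
  have [bu|ub] := ltP b (a + delta * v).
    have w0 : 0 < a + delta * v - b by rewrite subr_gt0.
    exists ((1 - b) / (a + delta * v - b)).
      rewrite divr_ge0 ?(ltW w0)//=; last by lra.
      by rewrite ler_pdivrMr// mul1r; lra.
    by field; rewrite gt_eqF.
  by exists 0; [rewrite lexx ler01|lra].
have /andP[lam0 lam1] := lam01.
pose q x := (1 - lam) * l x + lam * u x.
have mq : measurable_fun setT q.
  by apply: measurable_funD; apply: measurable_funM.
exists q; split.
- by move=> x; rewrite addr_ge0// mulr_ge0// subr_ge0.
- exact: measurable_funT_lebesgueType.
- move=> x _; rewrite -/l -/u -/(l x) -/(u x).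
  have lu := le_trans (lest x) (estu x).
  apply/andP; split; rewrite -subr_ge0.
    rewrite (_ : _ - _ = lam * (u x - l x)); last by rewrite /q; ring.
    by rewrite mulr_ge0// subr_ge0.
  rewrite (_ : _ - _ = (1 - lam) * (u x - l x)); last by rewrite /q; ring.
  by rewrite mulr_ge0// subr_ge0.
rewrite integral_leb//; last 2 first.
- by apply/measurable_EFinP; exact: measurable_funTS.
- by move=> x _; rewrite lee_fin addr_ge0// mulr_ge0// subr_ge0.
rewrite -lamE /q; under eq_integral do rewrite EFinD !EFinM.
rewrite ge0_integralD//; last 4 first.
- by move=> x _; rewrite mule_ge0 ?lee_fin// subr_ge0.
- by apply: measurable_funeM; exact/measurable_EFinP.
- by move=> x _; rewrite mule_ge0 ?lee_fin.
- by apply: measurable_funeM; exact/measurable_EFinP.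
rewrite !ge0_integralZl//.
- by rewrite uE bE -!EFinM -EFinD.
- exact/measurable_EFinP.
- by move=> x _; rewrite lee_fin.
- exact/measurable_EFinP.
- by move=> x _; rewrite lee_fin.
- by rewrite lee_fin subr_ge0.
Qed.

(** Triangle inequality through the estimator, where the mean square error is
    turned into a mean error by [`|e| <= eta + e ^+ 2 / eta]. *)
Lemma ambiguity_set_close (p q : 'rV[R]_m -> R) (eta z : R) :
  measurable_fun setT p -> 0 < eta ->
  (\int[mu]_(x in Xi) ((est x - p x) ^+ 2)%:E <= z%:E)%E ->
  ambiguity_set K Xi delta h t q ->
  (\int[leb m]_(x in Xi) `|p x - q x|%:E <= ((delta + eta) * v + z / eta)%:E)%E.
Proof.
move=> mp eta0 ez [q0 mq qlu _].
pose g x := delta + eta + eta^-1 * (est x - p x) ^+ 2.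
have g0 x : 0 <= g x.
  by rewrite !addr_ge0 ?(ltW eta0)// mulr_ge0 ?sqr_ge0// invr_ge0 ltW.
have msq : measurable_fun setT (fun x => (est x - p x) ^+ 2).
  by apply: measurable_funX; apply: measurable_funB.
have mg : measurable_fun setT g.
  by apply: measurable_funD => //; apply: measurable_funM.
have mXi' := borel_measurable_lebesgueType mXi.
apply: (@le_trans _ _ (\int[leb m]_(x in Xi) (g x)%:E)%E).
  apply: (integral_absB_le _ mXi' (measurable_funT_lebesgueType mp) mq
    (measurable_funT_lebesgueType mg)) => x Xix.
  have /andP[lq qu] := qlu x Xix.
  have qest : `|est x - q x| <= delta.
    rewrite ler_distl; move: lq qu; rewrite /band_lower /band_upper ge_max.
    by move=> /andP[_ lq] qu; apply/andP; split; rewrite /est; lra.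
  have estp : `|est x - p x| <= eta + eta^-1 * (est x - p x) ^+ 2.
    set e := est x - p x; rewrite -(@ler_pM2l _ eta)// mulrDr mulrA mulfV ?gt_eqF//.
    rewrite mul1r -[e ^+ 2]real_normK ?num_real//.
    have := sqr_ge0 (eta - `|e|); have := normr_ge0 e; nra.
  rewrite /g -addrA; apply: le_trans (lerD qest estp).
  rewrite [p x - q x](_ : _ = (est x - q x) - (est x - p x)); last by ring.
  exact: ler_normB.
rewrite integral_leb//; last 2 first.
- by apply/measurable_EFinP; exact: measurable_funTS.
- by move=> x _; rewrite lee_fin.
rewrite /g; under eq_integral do rewrite EFinD EFinM.
rewrite ge0_integralD//; last 3 first.
- by move=> x _; rewrite lee_fin addr_ge0// ltW.
- by move=> x _; rewrite mule_ge0 ?lee_fin ?sqr_ge0// invr_ge0 ltW.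
- by apply: measurable_funeM; apply/measurable_EFinP; exact: measurable_funTS.
rewrite integral_cst_Xi [leRHS]EFinD leeD2l//.
rewrite ge0_integralZl//; last 3 first.
- by apply/measurable_EFinP; exact: measurable_funTS.
- by move=> x _; rewrite lee_fin sqr_ge0.
- by rewrite lee_fin invr_ge0 ltW.
by rewrite mulrC EFinM lee_wpmul2l// lee_fin invr_ge0 ltW.
Qed.

End ambiguity.

(** The two costs differ by the integral of [f * (p - q)], which is at most [B]
    times the mean distance of [p] and [q]. *)
Lemma integral_cost_close d (T : measurableType d) (R : realType)
    (mu : {measure set T -> \bar R}) (D : set T) (f p q : T -> R) (B r : R) :
  measurable D -> measurable_fun D f -> 0 <= B ->
  (forall x, D x -> `|f x| <= B) ->
  (forall x, 0 <= p x) -> measurable_fun setT p ->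
  (\int[mu]_(x in D) (p x)%:E = 1)%E ->
  (forall x, 0 <= q x) -> measurable_fun setT q ->
  (\int[mu]_(x in D) (q x)%:E = 1)%E ->
  (\int[mu]_(x in D) `|p x - q x|%:E <= r%:E)%E ->
  let cost g := (\int[mu]_(x in D) (f x * g x)%:E)%E in
  [/\ `|cost p| <= B%:E, cost q <= cost p + (B * r)%:E &
      cost p - (B * r)%:E <= cost q]%E.
Proof.
move=> mD mf B0 fB p0 mp p1 q0 mq q1 pq cost.
have mfg (g : T -> R) : measurable_fun setT g ->
    measurable_fun D (fun x => (f x * g x)%:E).
  move=> mg; apply/measurable_EFinP; apply: measurable_funM => //.
  exact: measurable_funTS.
have bound (g : T -> R) (G : R) : measurable_fun setT g ->
    (\int[mu]_(x in D) `|g x|%:E <= G%:E)%E ->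
    (\int[mu]_(x in D) `|(f x * g x)%:E| <= (B * G)%:E)%E.
  move=> mg gG.
  have mag : measurable_fun D (fun x => `|g x|%:E).
    apply/measurable_EFinP.
    by apply: measurableT_comp => //; exact: measurable_funTS.
  apply: (@le_trans _ _ (\int[mu]_(x in D) (B%:E * `|g x|%:E))%E).
    apply: ge0_le_integral => //.
    - by apply: measurableT_comp => //; exact: mfg.
    - exact: measurable_funeM.
    by move=> x Dx; rewrite -EFinM lee_fin normrM ler_wpM2r// fB.
  by rewrite ge0_integralZl// EFinM lee_wpmul2l.
have abs1 (g : T -> R) : (forall x, 0 <= g x) ->
    (\int[mu]_(x in D) (g x)%:E = 1)%E ->
    (\int[mu]_(x in D) `|g x|%:E <= 1%:E)%E.
  by move=> g0 g1; under eq_integral do rewrite ger0_norm//; rewrite g1.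
have int (g : T -> R) : measurable_fun setT g ->
    (forall x, 0 <= g x) -> (\int[mu]_(x in D) (g x)%:E = 1)%E ->
    mu.-integrable D (fun x => (f x * g x)%:E).
  move=> mg g0 g1; apply/integrableP; split; first exact: mfg.
  by apply: le_lt_trans (bound g 1 mg (abs1 g g0 g1)) _; rewrite ltry.
have absI (g : T -> R) (G : R) : measurable_fun setT g ->
    (\int[mu]_(x in D) `|g x|%:E <= G%:E)%E -> (`|cost g| <= (B * G)%:E)%E.
  move=> mg gG; apply: le_trans (bound g G mg gG).
  by apply: le_abse_integral => //; exact: mfg.
have pB : (`|cost p| <= B%:E)%E.
  by rewrite -[B]mulr1; apply: absI => //; exact: abs1.
have diff : (`|cost p - cost q| <= (B * r)%:E)%E.
  rewrite /cost -integralB//; [|exact: int..].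
  under eq_integral do rewrite -EFinB -mulrBr.
  by apply: (absI (fun x => p x - q x)) => //; apply: measurable_funB.
have fp : cost p \is a fin_num.
  by rewrite fin_num_abs (le_lt_trans pB)// ltry.
have fq : cost q \is a fin_num.
  by apply: integrable_fin_num => //; exact: int.
move: pB diff; rewrite -(fineK fp) -(fineK fq) -!EFinB -EFinD /= !lee_fin.
set a := fine _; set b := fine _ => aB; rewrite ler_distl => /andP[h1 h2].
by split => //; lra.
Qed.

Lemma expected_cost_close (R : realType) m n (f : 'rV[R]_n -> 'rV[R]_m -> R)
    (Xi : set 'rV[R]_m) (p q : 'rV[R]_m -> R) (x : 'rV[R]_n) (B r : R) :
  measurable Xi -> 0 <= B ->
  measurable_fun (Xi : set (lebesgueType R m)) (f x) ->
  (forall xi, Xi xi -> `|f x xi| <= B) ->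
  (forall xi, 0 <= p xi) -> measurable_fun [set: lebesgueType R m] p ->
  (\int[leb m]_(xi in Xi) (p xi)%:E = 1)%E ->
  (forall xi, 0 <= q xi) -> measurable_fun [set: lebesgueType R m] q ->
  (\int[leb m]_(xi in Xi) (q xi)%:E = 1)%E ->
  (\int[leb m]_(xi in Xi) `|p xi - q xi|%:E <= r%:E)%E ->
  [/\ `|expected_cost f Xi p x| <= B%:E,
      expected_cost f Xi q x <= expected_cost f Xi p x + (B * r)%:E &
      expected_cost f Xi p x - (B * r)%:E <= expected_cost f Xi q x]%E.
Proof.
move=> mXi B0 mf fB p0 mp p1 q0 mq q1 pq.
exact: (integral_cost_close (borel_measurable_lebesgueType mXi) mf B0 fB
  p0 mp p1 q0 mq q1 pq).
Qed.

(** If all the members of a nonempty set [D] have costs within [e] of the cost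
    of [p], uniformly over the feasible set, then so have the worst cases, and
    taking infima over the feasible set preserves the gap. Nonemptiness
    matters: over the empty set the worst case is [-oo]. *)
Section robust_optimization.
Context {R : realType} {m n : nat} (f : 'rV[R]_n -> 'rV[R]_m -> R).
Variables (X : set 'rV[R]_n) (Xi : set 'rV[R]_m) (D : set ('rV[R]_m -> R)).
Variables (p : 'rV[R]_m -> R) (B e : R).
Hypotheses (X0 : X !=set0) (D0 : D !=set0).
Hypothesis close : forall x q, X x -> D q ->
  [/\ `|expected_cost f Xi p x| <= B%:E,
      expected_cost f Xi q x <= expected_cost f Xi p x + e%:E &
      expected_cost f Xi p x - e%:E <= expected_cost f Xi q x]%E.

Let cost x := expected_cost f Xi p x.

Let cost_fin x : X x -> cost x \is a fin_num.
Proof.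
move=> Xx; have [q Dq] := D0; have [pB _ _] := close Xx Dq.
by rewrite fin_num_abs (le_lt_trans pB)// ltry.
Qed.

Let worst_le x : X x -> (worst_case f Xi D x <= cost x + e%:E)%E.
Proof. by move=> Xx; apply: ge_ereal_sup => _ [q Dq <-]; have [] := close Xx Dq. Qed.

Let worst_ge x : X x -> (cost x - e%:E <= worst_case f Xi D x)%E.
Proof.
move=> Xx; have [q Dq] := D0; have [_ _ le] := close Xx Dq.
by apply: le_trans le _; apply: ereal_sup_ubound; exists q.
Qed.

Lemma worst_case_close :
  (ereal_sup [set `|expected_cost f Xi p x - worst_case f Xi D x| | x in X]
   <= e%:E)%E.
Proof.
apply: ge_ereal_sup => _ [x Xx <-].
have := worst_le Xx; have := worst_ge Xx; have := cost_fin Xx.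
rewrite /cost; case: expected_cost => // a _.
case: worst_case => [w| |]//; rewrite -?EFinD -?EFinB ?lee_fin//= => h1 h2.
by rewrite ?lee_fin ler_distl; apply/andP; split; lra.
Qed.

Lemma robust_value_close :
  (`|robust_value f X Xi D - ereal_inf [set expected_cost f Xi p x | x in X]|
   <= e%:E)%E.
Proof.
set a := ereal_inf _; set w := robust_value _ _ _ _.
have [x Xx] := X0; have [q Dq] := D0.
have aub : (a <= cost x)%E by apply: ereal_inf_lbound; exists x.
have alb : ((- B)%:E <= a)%E.
  apply: le_ereal_inf_tmp => _ [y Xy <-]; have [+ _ _] := close Xy Dq.
  by move: (cost_fin Xy); rewrite /cost; case: expected_cost => // c _;
    rewrite !lee_fin ler_norml => /andP[].
have afin : a \is a fin_num.
  rewrite fin_numElt (lt_le_trans _ alb) ?ltNyr//= (le_lt_trans aub)//.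
  by have := cost_fin Xx; rewrite fin_numElt => /andP[].
have wa : (w <= a + e%:E)%E.
  rewrite -leeBlDr//; apply: le_ereal_inf_tmp => _ [y Xy <-].
  rewrite leeBlDr//; apply: le_trans (worst_le Xy).
  by apply: ereal_inf_lbound; exists y.
have aw : (a - e%:E <= w)%E.
  apply: le_ereal_inf_tmp => _ [y Xy <-]; apply: le_trans (worst_ge Xy).
  by rewrite leeD2r//; apply: ereal_inf_lbound; exists y.
move: afin wa aw; case: a {aub alb} => // a _.
case: w => [w| |]//; rewrite -?EFinD -?EFinB ?lee_fin//= => h1 h2.
by rewrite ?lee_fin ler_distl; apply/andP; split; lra.
Qed.

End robust_optimization.

(** * Collars, inner probability and limits *)

Lemma compact_sub_cube (R : realType) m (Xi : set 'rV[R]_m) : compact Xi ->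
  exists2 r : R, 0 <= r & Xi `<=` @cube R m r.
Proof.
move=> /compact_bounded[r0 [_ rXi]].
pose r := Num.max 0 (r0 + 1); exists r; first by rewrite le_max lexx.
have r0r : r0 < r by rewrite lt_max ltrDl ltr01 orbT.
move=> x /(rXi r r0r) /= xr i /=.
rewrite in_itv /= -ler_norml; apply: le_trans xr.
rewrite [leRHS]mx_normrE.
exact: (le_bigmax_cond _ (fun ij => `|x ij.1 ij.2|) (j := (ord0, i))).
Qed.

Lemma borel_lebesgue_lty_cube (R : realType) m (A : set 'rV[R]_m) (r : R) :
  measurable A -> 0 <= r -> A `<=` @cube R m r -> (borel_lebesgue m A < +oo)%E.
Proof.
move=> mA r0 Ar; apply: (@le_lt_trans _ _ (borel_lebesgue m (@cube R m r))).
  apply: le_measure; rewrite ?inE//.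
  exact: measurable_box.
by rewrite borel_lebesgue_cube// ltry.
Qed.

(** The open neighbourhoods of radius [1 / (k + 1)] of a compact set decrease to
    the set itself and have finite measure, so the measures of the collars
    tend to [0]. *)
Lemma small_collar (R : realType) m (Xi : set 'rV[R]_m) (g : R) :
  closed Xi -> compact Xi -> 0 < g ->
  exists (V : set 'rV[R]_m) (eta : R),
    [/\ measurable V, Xi `<=` V, 0 < eta,
        forall x y, ~ V x -> Xi y -> eta <= norm2 (x - y) &
        (borel_lebesgue m (V `\` Xi) <= g%:E)%E].
Proof.
move=> cXi kXi g0.
have mXi := closed_measurable_rV cXi.
pose V k := \bigcup_(y in Xi) ball y (k.+1%:R^-1 : R).
have k0 k : 0 < k.+1%:R^-1 :> R by rewrite invr_gt0.
have mV k : measurable (V k).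
  by apply: open_measurable_rV; apply: bigcup_open => y _; exact: ball_open.
have XiV k : Xi `<=` V k by move=> y Xiy; exists y => //; exact: ballxx.
have Vdec k l : (k <= l)%N -> V l `<=` V k.
  move=> kl x [y Xiy yx]; exists y => //; apply: le_ball yx.
  by rewrite lef_pV2 ?posrE// ler_nat.
have Vfin : (borel_lebesgue m (V 0%N `\` Xi) < +oo)%E.
  have [r r0 Xir] := compact_sub_cube kXi.
  apply: (@borel_lebesgue_lty_cube _ _ _ (r + 1)).
  - exact: measurableD.
  - by rewrite addr_ge0.
  move=> x [[y /Xir yr [_ yx]] _] i /=.
  have := yr i; have := yx ord0 i; rewrite /ball /= invr1 !in_itv /=.
  by rewrite ltr_distl => /andP[h1 h2] /andP[h3 h4]; apply/andP; split; lra.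
have capV : \bigcap_k (V k `\` Xi) = set0.
  rewrite -subset0 => x Vx.
  have [_ nXi] := Vx 0%N I; apply: nXi; apply: cXi => A Ax.
  have /nbhs_ballP[e /= e0 eA] := Ax.
  have [k _ /(_ k (leqnn k)) ke] := near_infty_natSinv_lt (PosNum e0).
  have [[y Xiy yx] _] := Vx k I; exists y; split => //; apply: eA.
  by apply: ball_sym; apply: le_ball yx; exact: ltW.
have := @nonincreasing_cvg_mu _ _ _ (borel_lebesgue m) (fun k => V k `\` Xi) Vfin
  (fun k => measurableD (mV k) mXi).
rewrite capV measure0 => /(_ (@measurable0 _ _)) cv.
have {cv} : (borel_lebesgue m \o (fun k => V k `\` Xi)) k @[k --> \oo] --> 0%E.
  by apply: cv => k l kl; apply/subsetPset; apply: setSD; exact: Vdec.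
move=> /fine_cvgP[fn cv0].
have gN : \forall k \near \oo, `|fine (borel_lebesgue m (V k `\` Xi))| < g.
  by move: cv0 => /cvgr0Pnorm_lt; exact.
have [k [kfin kg]] : exists k, borel_lebesgue m (V k `\` Xi) \is a fin_num /\
    `|fine (borel_lebesgue m (V k `\` Xi))| < g.
  have [k _ /(_ k (leqnn k))] := filterI fn gN.
  by exists k.
exists (V k), k.+1%:R^-1; split => //.
  move=> x y nVx Xiy; rewrite leNgt; apply/negP => xy; apply: nVx.
  exists y => //; rewrite -ball_normE /=.
  by rewrite distrC (le_lt_trans (ler_mx_norm_norm2 _)).
by rewrite -(fineK kfin) lee_fin (le_trans (ler_norm _))// ltW.
Qed.

(** Each of the two bounds fails with probability at most [theta / 2] by
    Markov's inequality, and their conjunction is a measurable event contained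
    in [E], as the inner measure requires. *)
Lemma inner_prob_ge d (Omega : measurableType d) (R : realType)
    (P : probability Omega R) (g1 g2 : Omega -> \bar R) (c1 c2 theta : R)
    (E : set Omega) :
  0 < c1 -> 0 < c2 -> measurable_fun setT g1 -> measurable_fun setT g2 ->
  (forall w, 0 <= g1 w)%E -> (forall w, 0 <= g2 w)%E ->
  (\int[P]_w g1 w <= (theta / 2 * c1)%:E)%E ->
  (\int[P]_w g2 w <= (theta / 2 * c2)%:E)%E ->
  (forall w, g1 w <= c1%:E -> g2 w <= c2%:E -> E w)%E ->
  ((1 - theta)%:E <= inner_prob P E)%E.
Proof.
move=> c10 c20 mg1 mg2 g10 g20 I1 I2 gE.
have mle (g : Omega -> \bar R) (c : R) : measurable_fun setT g ->
    measurable [set w | g w <= c%:E]%E.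
  move=> mg; rewrite -[X in measurable X]setTI.
  exact: emeasurable_fun_infty_c.
pose A1 := [set w | g1 w <= c1%:E]%E; pose A2 := [set w | g2 w <= c2%:E]%E.
have mA1 : measurable A1 by exact: mle.
have mA2 : measurable A2 by exact: mle.
have mA : measurable (A1 `&` A2) by exact: measurableI.
apply: (@le_trans _ _ (P (A1 `&` A2))); last first.
  by apply: ereal_sup_ubound; exists (A1 `&` A2) => //; split => // w [/= h1 h2]; exact: gE.
have PC : (P (~` (A1 `&` A2)) <= theta%:E)%E.
  rewrite setCI; apply: le_trans (measureU2 _ _ _) _; try exact: measurableC.
  rewrite (splitr theta) EFinD; apply: leeD.
    exact: (markov_ge0 c10 mg1 g10 I1).
  exact: (markov_ge0 c20 mg2 g20 I2).
have := probability_setC P mA => PE.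
rewrite EFinB leeBlDr//; apply: (@le_trans _ _ (P (A1 `&` A2) + P (~` (A1 `&` A2)))%E).
  rewrite PE addeC subeK//.
  by rewrite fin_num_measure.
by rewrite leeD2l.
Qed.

Lemma cvg0_eventually_le (R : realType) (u : nat -> R) (e : R) : 0 < e ->
  u N @[N --> \oo] --> (0 : R) ->
  exists N0, forall N, (N0 <= N)%N -> u N <= e.
Proof.
move=> e0 u0; have [N0 _ uN] : \forall N \near \oo, `|u N| < e.
  by move: u0 => /cvgr0Pnorm_lt; exact.
by exists N0 => N /uN /= /ltW; apply: le_trans; exact: ler_norm.
Qed.

Lemma ereal_sup_abs_bound (R : realType) T (A : set T) (g : T -> R) :
  (ereal_sup [set `|g z|%:E | z in A] < +oo)%E ->
  exists2 B : R, 0 < B & forall z, A z -> `|g z| <= B.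
Proof.
move=> gA.
have gS z : A z -> (`|g z|%:E <= ereal_sup [set `|g z|%:E | z in A])%E.
  by move=> Az; apply: ereal_sup_ubound; exists z.
move: gA gS; case: ereal_sup => [r| |]// _ gS.
  exists (Num.max 1 r); first by rewrite lt_max ltr01.
  by move=> z Az; rewrite le_max -lee_fin -[(_ <= r)]lee_fin gS// orbT.
by exists 1 => // z /gS; rewrite leeNy_eq.
Qed.

(** * Consistency *)

Lemma powR_le_of_le (R : realType) (x a r : R) : 0 < r -> 0 <= x -> 0 < a ->
  x <= a `^ r^-1 -> x `^ r <= a.
Proof.
move=> r0 x0 a0 xa; have -> : a = (a `^ r^-1) `^ r.
  by rewrite -powRrM mulVf ?gt_eqF// powRr1// ltW.
by rewrite ge0_ler_powR ?nnegrE ?powR_ge0// ltW.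
Qed.

(** The optimal value integrates over the whole space, the robust value over
    the support. *)
Lemma expected_cost_support (R : realType) m n (f : 'rV[R]_n -> 'rV[R]_m -> R)
    (Xi : set 'rV[R]_m) (p : 'rV[R]_m -> R) x :
  (forall y, ~ Xi y -> p y = 0) ->
  expected_cost f setT p x = expected_cost f Xi p x.
Proof.
move=> pXi; rewrite /expected_cost [RHS]integral_mkcond.
apply: eq_integral => y _; rewrite patchE; case: ifPn => // /negP nXi.
by rewrite pXi ?mulr0// => Xiy; apply: nXi; rewrite inE.
Qed.

Theorem theorem4 (R : realType) (m n : nat)
    (p : 'rV[R]_m -> R) (Xi : set 'rV[R]_m)
    (X : set 'rV[R]_n) (f : 'rV[R]_n -> 'rV[R]_m -> R)
    (K : 'rV[R]_m -> R) (kappa : R -> R)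
    (alpha C rho U : R) (h : nat -> R) :
  (0 < m)%N ->
  is_density p ->
  Xi = density_support p ->
  compact Xi ->
  0 < alpha < 1 ->
  0 < C -> 0 < rho -> holder C rho p ->
  (forall xi, Xi xi -> p xi <= U) ->
  radial_kernel K kappa ->
  X !=set0 ->
  (forall x, X x -> measurable_fun (Xi : set (lebesgueType R m)) (f x)) ->
  (ereal_sup [set `|f z.1 z.2|%:E | z in X `*` Xi] < +oo)%E ->
  (forall N, (0 < N)%N ->
     (ln (N%:R / alpha) / N%:R) `^ (m%:R^-1) < h N) ->
  (* vanishing bandwidth, asymptotically dominating the lower bound above:
     equivalently, the half-width of the confidence band tends to 0 *)
  h N @[N --> \oo] --> (0 : R) ->
  ln (N%:R / alpha) / (N%:R * h N ^+ m) @[N --> \oo] --> (0 : R) ->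
  forall eps theta : R, 0 < eps -> 0 < theta < 1 ->
  exists N0 : nat, forall N : nat, (N0 <= N)%N ->
  forall (d : measure_display) (Omega : measurableType d)
    (P : probability Omega R) (s : 'I_N -> {RV P >-> 'rV[R]_m}),
  iid_sample p s ->
  let D := fun omega : Omega =>
    ambiguity_set K Xi (half_width m kappa C rho U alpha (h N) N) (h N)
      (fun i => s i omega) in
  ((1 - theta)%:E <=
     inner_prob P [set omega |
       ereal_sup [set `|expected_cost f Xi p x
                        - worst_case f Xi (D omega) x| | x in X]
         <= eps%:E])%E /\
  ((1 - theta)%:E <=
     inner_prob P [set omega |
       `|robust_value f X Xi (D omega) - stochastic_value f X p|
         <= eps%:E])%E.

Proof.
move=> m0 [p0 mpL p1L] XiE kXi /andP[al0 al1] C0 rho0 pH pU radialK X0 mf fsup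
  hlb hcv Lcv eps theta eps0 /andP[th0 _].
pose mu := borel_lebesgue (R := R) m.
have mp := holder_measurable C0 rho0 pH.
have cXi : closed Xi by rewrite XiE; exact: closed_closure.
have mXi := closed_measurable_rV cXi.
have pXi y : ~ Xi y -> p y = 0.
  move=> nXi; apply: contrapT => /eqP py; apply: nXi; rewrite XiE.
  exact: subset_closure.
have p1 : (\int[mu]_y (p y)%:E = 1)%E.
  rewrite -p1L integral_leb//; first exact/measurable_EFinP.
  by move=> y _; rewrite lee_fin.
have p1Xi : (\int[mu]_(y in Xi) (p y)%:E = 1)%E.
  rewrite -p1 integral_mkcond; apply: eq_integral => y _.
  rewrite patchE; case: ifPn => // /negP nXi.
  by rewrite pXi// => Xiy; apply: nXi; rewrite inE.
have p1XiL : (\int[leb m]_(y in Xi) (p y)%:E = 1)%E.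
  rewrite integral_leb//; first by apply/measurable_EFinP; exact: measurable_funTS.
  by move=> y _; rewrite lee_fin.
have [v muXi] : exists v, mu Xi = v%:E.
  have [r r0 Xir] := compact_sub_cube kXi.
  exists (fine (mu Xi)); rewrite fineK// ge0_fin_numE//.
  exact: borel_lebesgue_lty_cube Xir.
have v0 : 0 < v.
  have v0 : 0 <= v by rewrite -lee_fin -muXi.
  rewrite lt_neqAle v0 andbT eq_sym; apply/eqP => v00.
  suff : (1 <= 0 :> \bar R)%E by rewrite lee_fin ler10.
  rewrite -p1Xi; apply: (@le_trans _ _ (\int[mu]_(y in Xi) U%:E)%E).
    apply: ge0_le_integral => //.
    - by move=> y _; rewrite lee_fin.
    - by apply/measurable_EFinP; exact: measurable_funTS.
  by rewrite integral_cst// [X in (_ * X)%E](_ : _ = v%:E)// v00 mule0.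
have [B B0 fB] : exists2 B : R, 0 < B &
    forall z, (X `*` Xi) z -> `|f z.1 z.2| <= B by exact: ereal_sup_abs_bound fsup.
have [M M0 KM] := radial_kernel_moment radialK (ltW rho0).
have q0 : 0 <= rho + 1 by rewrite addr_ge0// ltW.
have [Mq Mq0 KMq] := radial_kernel_moment radialK q0.
set c1 := C1 m kappa C rho.
have c10 : 0 < c1 := C1_gt0 radialK m0 C0 rho0.
set c2 := C2 m kappa U.
have c20 : 0 <= c2 := C2_ge0 radialK U.
have k00 : 0 <= kappa 0 by have [_ _ _ [k00 _] _] := radialK; exact: k00.
pose c := ln alpha^-1.
have c0 : 0 < c by rewrite ln_gt0// invf_gt1.
(* [A], [eta] and [z] split the error [B * ((delta + eta) * v + z / eta)] into
   three parts that are at most [eps / 3] once [delta <= eta] *)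
pose A := eps / (3 * B).
have A0 : 0 < A by rewrite divr_gt0// mulr_gt0.
pose eta := A / v.
have eta0 : 0 < eta by rewrite divr_gt0.
pose z := eta * A.
have z0 : 0 < z by rewrite mulr_gt0.
(* the collar is so thin that its share of the expected leak is at most
   [theta / 4 * (c1 * h `^ rho * v)] *)
pose g := theta / 4 * c1 * v / (C * M + 1).
have CM1 : 0 < C * M + 1 by rewrite ltr_wpDl// mulr_ge0// ltW.
have th4 : 0 < theta / 4 by rewrite divr_gt0.
have half_split y : theta / 2 * y = theta / 4 * y + theta / 4 * y by field.
have g0 : 0 < g by rewrite divr_gt0// mulr_gt0// mulr_gt0.
have [V [d0 [mV XiV d00 Vfar muV]]] := small_collar cXi kXi g0.
have d0q : 0 < d0 `^ (rho + 1) by rewrite powR_gt0.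
(* Thresholds for large [N]: below [a], [h N `^ rho] makes the bias part of
   [delta] ([a1]) and the squared bias ([a2]) small; below [b1], [h N] makes
   the leak beyond the collar small; below [e1] and [e2], the stochastic
   quantity makes the second part of [delta] and the variance small. *)
pose a1 := eta / 2 / c1.
have a10 : 0 < a1 by rewrite divr_gt0// divr_gt0.
have CMv : 0 < (C * M) ^+ 2 * v + 1.
  by rewrite ltr_wpDl// mulr_ge0 ?sqr_ge0// ltW.
pose a2 := theta / 4 * z / ((C * M) ^+ 2 * v + 1).
have a20 : 0 < a2 by rewrite divr_gt0// mulr_gt0.
pose a := Num.min 1 (Num.min a1 a2).
have a0 : 0 < a by rewrite !lt_min ltr01 a10 a20.
pose b1 := theta / 4 * c1 * v * d0 `^ (rho + 1) / (Mq + 1).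
have Mq1 : 0 < Mq + 1 by rewrite ltr_wpDl.
have b10 : 0 < b1 by rewrite divr_gt0// mulr_gt0// mulr_gt0// mulr_gt0.
have c21 : 0 < c2 + 1 by rewrite ltr_wpDl.
pose e1 := (eta / 2 / (c2 + 1)) ^+ 2.
have e10 : 0 < e1 by rewrite exprn_gt0// divr_gt0// divr_gt0.
have k01 : 0 < kappa 0 + 1 by rewrite ltr_wpDl.
pose e2 := theta / 4 * z * c / (kappa 0 + 1).
have e20 : 0 < e2 by rewrite divr_gt0// mulr_gt0// mulr_gt0.
have eh0 : 0 < Num.min (a `^ rho^-1) b1 by rewrite lt_min powR_gt0.
have eL0 : 0 < Num.min e1 e2 by rewrite lt_min e10.
have [N1 hN1] := cvg0_eventually_le eh0 hcv.
have [N2 LN2] := cvg0_eventually_le eL0 Lcv.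
exists (maxn 1 (maxn N1 N2)) => N; rewrite !geq_max => /and3P[N0 NN1 NN2].
move=> d Omega P s iid.
have hN0 : 0 < h N by exact: le_lt_trans (powR_ge0 _ _) (hlb N N0).
have NR : 0 < N%:R :> R by rewrite ltr0n.
have hm0 : 0 < h N ^+ m by rewrite exprn_gt0.
have /andP[ha hb] : (h N <= a `^ rho^-1) && (h N <= b1).
  by rewrite -le_min; exact: hN1.
set H := h N `^ rho.
have H0 : 0 < H by rewrite powR_gt0.
have Ha : H <= a by exact: powR_le_of_le (ltW hN0) a0 ha.
have [H1 Ha1 Ha2] : [/\ H <= 1, H <= a1 & H <= a2].
  by move: Ha; rewrite !le_min => /and3P[].
set L := ln (N%:R / alpha) / (N%:R * h N ^+ m).
have /andP[Le1 Le2] : (L <= e1) && (L <= e2) by rewrite -le_min; exact: LN2.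
set delta := half_width m kappa C rho U alpha (h N) N.
have deltaE : delta = c1 * H + c2 * Num.sqrt L by [].
have sL0 : 0 <= Num.sqrt L by exact: sqrtr_ge0.
have delta_ge : c1 * H <= delta by rewrite deltaE lerDl mulr_ge0.
have delta0 : 0 <= delta by apply: le_trans delta_ge; rewrite mulr_ge0 ?ltW.
have delta_le : delta <= eta.
  rewrite deltaE (splitr eta) lerD//.
    by rewrite mulrC -ler_pdivlMr.
  have sL : Num.sqrt L <= eta / 2 / (c2 + 1).
    have e00 : 0 <= eta / 2 / (c2 + 1) by rewrite ltW// divr_gt0// divr_gt0.
    by rewrite -(ger0_norm e00) -sqrtr_sqr ler_wsqrtr.
  apply: (@le_trans _ _ ((c2 + 1) * (eta / 2 / (c2 + 1)))).
    by rewrite ler_pM// lerDl.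
  by rewrite mulrC divfK// gt_eqF.
have knoise : kappa 0 / (N%:R * h N ^+ m) <= theta / 4 * z.
  have Nh0 : 0 < N%:R * h N ^+ m by rewrite mulr_gt0.
  (* [ln (N / alpha)] is bounded below by the positive constant [c] *)
  have cL : c / (N%:R * h N ^+ m) <= L.
    rewrite /L ler_wpM2r ?invr_ge0 ?(ltW Nh0)// /c ler_ln ?posrE ?invr_gt0//.
      by rewrite ler_peMl ?invr_ge0 ?(ltW al0)// ler1n.
    by rewrite divr_gt0.
  have : c / (N%:R * h N ^+ m) <= theta / 4 * z * c / (kappa 0 + 1).
    exact: le_trans cL Le2.
  rewrite ler_pdivlMr// => le1.
  rewrite -(@ler_pM2r _ c)//; apply: le_trans le1.
  rewrite mulrAC [leRHS]mulrAC ler_wpM2r ?invr_ge0 ?(ltW Nh0)//.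
  by rewrite mulrDr mulr1 mulrC lerDl ltW.
pose est w := kde K (h N) (fun i => s i w).
have [mZ EZ] := expected_square_error radialK hN0 p0 mp p1 N0 iid mXi C0 pH KM.
have {}EZ : (\int[P]_w \int[mu]_(x in Xi) ((est w x - p x) ^+ 2)%:E <=
    (theta / 2 * z)%:E)%E.
  apply: le_trans EZ _; rewrite [X in (_ * X + _)%E](_ : _ = v%:E)//.
  rewrite -EFinM -EFinD lee_fin.
  rewrite half_split lerD// -/H.
  apply: (@le_trans _ _ (((C * M) ^+ 2 * v + 1) * a2)); last first.
    by rewrite mulrC divfK// gt_eqF.
  rewrite (_ : (C * (H * M)) ^+ 2 * v = (C * M) ^+ 2 * v * H ^+ 2); last by ring.
  have CMv0 : 0 <= (C * M) ^+ 2 * v by rewrite mulr_ge0 ?sqr_ge0// ltW.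
  rewrite ler_pM ?sqr_ge0 ?lerDl//; apply: le_trans Ha2.
  by rewrite expr2 ler_piMl// ltW.
have [mL EL] := expected_leak radialK hN0 p0 mp p1 N0 iid mXi.
have {}EL : (\int[P]_w \int[mu]_(x in ~` Xi) (est w x)%:E <=
    (theta / 2 * (c1 * H * v))%:E)%E.
  rewrite [leLHS]EL.
  apply: le_trans (smoothed_leak radialK hN0 p0 mp p1 C0 pH KM mXi mV pXi XiV
    d00 q0 Vfar KMq) _.
  rewrite half_split EFinD leeD//.
    apply: (@le_trans _ _ ((C * (H * M))%:E * g%:E)%E).
      by rewrite lee_wpmul2l// lee_fin mulr_ge0 ?(ltW C0)// mulr_ge0 ?(ltW H0).
    rewrite -EFinM lee_fin.
    apply: (@le_trans _ _ (H * ((C * M + 1) * g))).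
      rewrite (_ : C * (H * M) * g = H * (C * M * g)); last by ring.
      by rewrite ler_pM2l// ler_pM2r// lerDl.
    rewrite [(_ + 1) * g]mulrC divfK ?gt_eqF// le_eqVlt; apply/orP; left.
    by apply/eqP; ring.
  rewrite lee_fin ler_pdivrMl// powRD; last by apply/implyP => _; rewrite gt_eqF.
  rewrite -/H powRr1 ?(ltW hN0)//.
  apply: (@le_trans _ _ (H * (b1 * (Mq + 1)))).
    rewrite -mulrA ler_pM2l// ler_pM ?(ltW hN0)//.
    by rewrite lerDl.
  rewrite divfK ?gt_eqF// le_eqVlt; apply/orP; left.
  by apply/eqP; ring.
have c1Hv : 0 < c1 * H * v by rewrite mulr_gt0// mulr_gt0.
pose D w := ambiguity_set K Xi delta (h N) (fun i => s i w).
have key w : (\int[mu]_(x in Xi) ((est w x - p x) ^+ 2)%:E <= z%:E)%E ->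
    (\int[mu]_(x in ~` Xi) (est w x)%:E <= (c1 * H * v)%:E)%E ->
    D w !=set0 /\ forall x q, X x -> D w q ->
      [/\ `|expected_cost f Xi p x| <= B%:E,
          expected_cost f Xi q x <= expected_cost f Xi p x + eps%:E &
          expected_cost f Xi p x - eps%:E <= expected_cost f Xi q x]%E.
  move=> Zw Lw; split.
    apply: (ambiguity_set_nonempty radialK hN0 N0 mXi muXi delta0).
    by apply: le_trans Lw _; rewrite lee_fin ler_wpM2r// ltW.
  move=> x q Xx Dq; have [qpos mq _ q1] := Dq.
  have pq := ambiguity_set_close radialK mXi muXi delta0 mp eta0 Zw Dq.
  have [h1 h2 h3] := expected_cost_close mXi (ltW B0) (mf x Xx)
    (fun xi Xixi => fB (x, xi) (conj Xx Xixi)) p0 mpL p1XiL qpos mq q1 pq.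
  have Beps : B * ((delta + eta) * v + z / eta) <= eps.
    rewrite (_ : z / eta = A); last by rewrite /z mulrC mulKf// gt_eqF.
    apply: (@le_trans _ _ (B * ((eta + eta) * v + A))).
      by rewrite ler_pM2l// lerD2r ler_pM2r// lerD2r.
    rewrite le_eqVlt; apply/orP; left; apply/eqP; rewrite /eta /A; field.
    by rewrite !gt_eqF.
  split => //.
    by apply: le_trans h2 _; rewrite leeD2l// lee_fin.
  by apply: le_trans h3; rewrite leeD2l// leeN2 lee_fin.
have Z0 w : (0 <= \int[mu]_(x in Xi) ((est w x - p x) ^+ 2)%:E)%E.
  by apply: integral_ge0 => x _; rewrite lee_fin sqr_ge0.
have L0 w : (0 <= \int[mu]_(x in ~` Xi) (est w x)%:E)%E.
  by apply: integral_ge0 => x _; rewrite lee_fin (kde_ge0 radialK hN0).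
split.
  apply: (inner_prob_ge z0 c1Hv mZ mL Z0 L0 EZ EL) => w Zw Lw.
  have [D0 close] := key w Zw Lw.
  exact: worst_case_close D0 close.
apply: (inner_prob_ge z0 c1Hv mZ mL Z0 L0 EZ EL) => w Zw Lw.
have [D0 close] := key w Zw Lw.
rewrite /= (_ : stochastic_value f X p =
  ereal_inf [set expected_cost f Xi p x | x in X]).
  exact: robust_value_close X0 D0 close.
rewrite /stochastic_value; congr ereal_inf; apply: eq_imagel => x _.
exact: expected_cost_support.
Qed.
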